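(* Let $X$ be a connected Noetherian affine scheme and let $\mathfrak{F}$ and $\mathfrak{G}$ be coherent sheaves of $\mathcal{O}_X$-modules. Then $\mathfrak{F}\sim\mathfrak{G}$ if and only if $\Gamma(X,\mathfrak{F})\sim\Gamma(X,\mathfrak{G})$ (as $\Gamma(X,\mathcal{O}_X)$-modules).
   Context: Modules: for a finitely generated module $M$ over a commutative Noetherian ring $R$ take a minimal free presentation $F_2\xrightarrow{f}F_1\xrightarrow{g}M\to0$ by free modules of finite rank (ranks as small as possible); with $(-)^+:=\mathrm{Hom}_R(-,R)$ put $\mathrm{Tr}\,M:=\mathrm{Coker}(f^+)$ and $\lambda M:=\mathrm{Coker}(g^+)=\Omega\,\mathrm{Tr}\,M$, where $\Omega$ is the first syzygy. Modules $M,N$ are linked, $M\sim N$, if $M\cong\lambda N$ and $N\cong\lambda M$. Sheaves: if $\mathcal{O}_X^{\oplus t_2}\xrightarrow{\phi}\mathcal{O}_X^{\oplus t_1}\xrightarrow{\varphi}\mathfrak{F}\to0$ is a free presentation with $t_1,t_2$ smallest possible, and $(-)^*:=\mathcal{H}om_{\mathcal{O}_X}(-,\mathcal{O}_X)$, put $\overline{\mathrm{Tr}}\,\mathfrak{F}:=\mathrm{Coker}(\phi^* )$ and $\overline{\lambda}\,\mathfrak{F}:=\mathrm{Coker}(\varphi^* )=\Omega(\overline{\mathrm{Tr}}\,\mathfrak{F})$. Sheaves $\mathfrak{F},\mathfrak{G}$ are linked, $\mathfrak{F}\sim\mathfrak{G}$, if $\mathfrak{F}\cong\overline{\lambda}\,\mathfrak{G}$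 and $\mathfrak{G}\cong\overline{\lambda}\,\mathfrak{F}$. *)

(* Defs.v *)
From HB Require Import structures.
From mathcomp Require Import all_boot all_order all_algebra.
From mathcomp Require Import all_classical topology.

Set Implicit Arguments.
Unset Strict Implicit.
Unset Printing Implicit Defensive.

Import GRing.Theory.
Local Open Scope classical_set_scope.
Local Open Scope ring_scope.

Record opens (T : topologicalType) := Opens {
  open_set :> set T;
  open_setP : open open_set }.

Definition open_full (T : topologicalType) : opens T := Opens openT.

Definition open_cap (T : topologicalType) (U V : opens T) : opens T :=
  Opens (openI (open_setP U) (open_setP V)).

(* The restriction maps depend on a proof of [V `<=` U]; functoriality is
   required below for all such proofs, so the choice of proof is immaterial. *)
Definition is_sheaf (T : topologicalType) (F : opens T -> Type)
    (res : forall U V : opens T, V `<=` U -> F U -> F V) : Prop :=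
  forall (I : Type) (U : opens T) (W : I -> opens T)
    (WU : forall i, W i `<=` U),
  U `<=` \bigcup_i W i ->
  forall s : (forall i, F (W i)),
  (forall i j (V : opens T) (Vi : V `<=` W i) (Vj : V `<=` W j),
     res _ _ Vi (s i) = res _ _ Vj (s j)) ->
  exists! t : F U, forall i, res _ _ (WU i) t = s i.

Definition locally_on (T : topologicalType) (U : opens T)
    (P : forall V : opens T, V `<=` U -> Prop) : Prop :=
  forall x, open_set U x ->
    exists (V : opens T) (VU : V `<=` U), open_set V x /\ P V VU.

(* Rings may be zero: the ring of sections over the empty set always is. *)
Record ringed_space := RingedSpace {
  rs_space :> topologicalType;
  rs_ring : opens rs_space -> comPzRingType;
  rs_res : forall U V : opens rs_space, V `<=` U ->
    {rmorphism rs_ring U -> rs_ring V};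
  rs_res_id : forall (U : opens rs_space) (h : U `<=` U) a, rs_res h a = a;
  rs_res_comp : forall (U V W : opens rs_space)
    (VU : V `<=` U) (WV : W `<=` V) (WU : W `<=` U) a,
    rs_res WV (rs_res VU a) = rs_res WU a;
  rs_sheaf : is_sheaf (fun U V VU => @rs_res U V VU) }.

Record omodule (X : ringed_space) := OModule {
  om_sec :> forall U : opens X, lmodType (rs_ring U);
  om_res : forall (U V : opens X) (VU : V `<=` U),
    {linear om_sec U -> om_sec V | rs_res VU \; *:%R};
  om_res_id : forall (U : opens X) (h : U `<=` U) x, om_res h x = x;
  om_res_comp : forall (U V W : opens X)
    (VU : V `<=` U) (WV : W `<=` V) (WU : W `<=` U) x,
    om_res WV (om_res VU x) = om_res WU x;
  om_sheaf : is_sheaf (fun U V VU => @om_res U V VU) }.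

Arguments om_res {X o U V} VU.

Definition global_sections (X : ringed_space) (F : omodule X) :
  lmodType (rs_ring (open_full X)) := F (open_full X).

Record omorphism (X : ringed_space) (F G : omodule X) := OMorphism {
  omor :> forall U : opens X, {linear F U -> G U};
  omor_nat : forall (U V : opens X) (VU : V `<=` U) x,
    om_res VU (omor U x) = omor V (om_res VU x) }.

Section FreeSheaf.
Variables (X : ringed_space) (n : nat).
Implicit Types U V W : opens X.

Definition free_res (U V : opens X) (VU : V `<=` U)
  (x : 'rV[rs_ring U]_n) : 'rV[rs_ring V]_n := map_mx (rs_res VU) x.

Fact free_res_linear U V (VU : V `<=` U) :
  linear_for (rs_res VU \; *:%R) (@free_res U V VU).
Proof. by move=> a x y; apply/rowP => i; rewrite !mxE rmorphD rmorphM. Qed.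

HB.instance Definition _ U V (VU : V `<=` U) :=
  GRing.isLinear.Build _ _ _ _ _ (free_res_linear VU).

Fact free_res_id (U : opens X) (h : U `<=` U) x : free_res h x = x.
Proof. by apply/rowP => i; rewrite !mxE rs_res_id. Qed.

Fact free_res_comp (U V W : opens X)
  (VU : V `<=` U) (WV : W `<=` V) (WU : W `<=` U) x :
  free_res WV (free_res VU x) = free_res WU x.
Proof. by apply/rowP => i; rewrite !mxE (rs_res_comp VU WV WU). Qed.

Fact free_sheaf_axiom : is_sheaf free_res.
Proof.
move=> I U W WU cov s compat.
have H (k : 'I_n) : exists! t, forall i, rs_res (WU i) t = s i 0 k.
  apply: (@rs_sheaf X I U W WU cov (fun i => s i 0 k)) => i j V Vi Vj.
  by have /rowP/(_ k) := compat i j V Vi Vj; rewrite !mxE.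
have /choice [t Ht] : forall k, exists t,
    (forall i, rs_res (WU i) t = s i 0 k) /\
    forall t', (forall i, rs_res (WU i) t' = s i 0 k) -> t = t'.
  by move=> k; have [t [? ?]] := H k; exists t.
exists (\row_k t k); split=> [i|t' Ht'].
  by apply/rowP => k; rewrite !mxE (Ht k).1.
apply/rowP => k; rewrite mxE; apply: (Ht k).2 => i.
by rewrite -Ht' !mxE.
Qed.

Definition free_sheaf : omodule X :=
  @OModule X (fun U => 'rV[rs_ring U]_n) (fun U V VU => @free_res U V VU)
    free_res_id free_res_comp free_sheaf_axiom.

End FreeSheaf.

Section StructureSheaf.
Variable X : ringed_space.
Implicit Types U V W : opens X.

Definition struct_res (U V : opens X) (VU : V `<=` U)
  (x : (rs_ring U)^o) : (rs_ring V)^o := rs_res VU x.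

Fact struct_res_linear U V (VU : V `<=` U) :
  linear_for (rs_res VU \; *:%R) (@struct_res U V VU).
Proof. by move=> a x y; rewrite /struct_res rmorphD rmorphM. Qed.

HB.instance Definition _ U V (VU : V `<=` U) :=
  GRing.isLinear.Build _ _ _ _ _ (struct_res_linear VU).

Definition struct_sheaf : omodule X :=
  @OModule X (fun U => (rs_ring U)^o) (fun U V VU => @struct_res U V VU)
    (@rs_res_id X) (@rs_res_comp X) (@rs_sheaf X).

End StructureSheaf.

Lemma linear_ext (R : pzRingType) (M N : lmodType R) (f g : {linear M -> N}) :
  (forall x, f x = g x) -> f = g.
Proof.
case: f g => [f [[a] [b]]] [g [[a'] [b']]] /= e.
have {}e : f = g by apply/funext.
subst g.
by rewrite (Prop_irrelevance a a') (Prop_irrelevance b b').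
Qed.

Section HomSheaf.
Variables (X : ringed_space) (F G : omodule X).
Implicit Types U V W T : opens X.

(* A morphism from the restriction of F to U to the restriction of G to U. *)
Record hom_on (U : opens X) := HomOn {
  hom_fun :> forall V : opens X, V `<=` U -> {linear F V -> G V};
  hom_nat : forall (V W : opens X) (VU : V `<=` U) (WU : W `<=` U)
    (WV : W `<=` V) x,
    om_res WV (hom_fun VU x) = hom_fun WU (om_res WV x) }.

Lemma hom_on_ext (U : opens X) (f g : hom_on U) :
  (forall V (VU : V `<=` U) x, f V VU x = g V VU x) -> f = g.
Proof.
case: f g => [f nf] [g ng] /= e.
have {}e : f = g.
  apply: functional_extensionality_dep => V.
  apply: functional_extensionality_dep => VU.
  exact: linear_ext (e V VU).
by subst g; rewrite (Prop_irrelevance nf ng).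
Qed.

HB.instance Definition _ U := gen_eqMixin (hom_on U).
HB.instance Definition _ U := gen_choiceMixin (hom_on U).

Section Module.
Variable U : opens X.

Fact hom_zero_nat V W (VU : V `<=` U) (WU : W `<=` U) (WV : W `<=` V) x :
  om_res WV ((\0 : {linear F V -> G V}) x) =
  (\0 : {linear F W -> G W}) (om_res WV x).
Proof. by rewrite /= linear0. Qed.
Definition hom_zero := HomOn hom_zero_nat.

Fact hom_opp_nat (f : hom_on U) V W (VU : V `<=` U) (WU : W `<=` U)
  (WV : W `<=` V) x :
  om_res WV ((\- (f V VU) : {linear F V -> G V}) x) =
  (\- (f W WU) : {linear F W -> G W}) (om_res WV x).
Proof. by rewrite /= linearN (hom_nat f VU WU). Qed.
Definition hom_opp f := HomOn (hom_opp_nat f).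

Fact hom_add_nat (f g : hom_on U) V W (VU : V `<=` U) (WU : W `<=` U)
  (WV : W `<=` V) x :
  om_res WV ((f V VU \+ g V VU : {linear F V -> G V}) x) =
  (f W WU \+ g W WU : {linear F W -> G W}) (om_res WV x).
Proof. by rewrite /= linearD !(hom_nat _ VU WU). Qed.
Definition hom_add f g := HomOn (hom_add_nat f g).

Fact hom_addA : associative hom_add.
Proof. by move=> f g h; apply: hom_on_ext => V VU x /=; rewrite addrA. Qed.
Fact hom_addC : commutative hom_add.
Proof. by move=> f g; apply: hom_on_ext => V VU x /=; rewrite addrC. Qed.
Fact hom_add0 : left_id hom_zero hom_add.
Proof. by move=> f; apply: hom_on_ext => V VU x /=; rewrite add0r. Qed.
Fact hom_addN : left_inverse hom_zero hom_opp hom_add.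
Proof. by move=> f; apply: hom_on_ext => V VU x /=; rewrite addNr. Qed.

HB.instance Definition _ :=
  GRing.isZmodule.Build (hom_on U) hom_addA hom_addC hom_add0 hom_addN.

Fact hom_scale_nat (a : rs_ring U) (f : hom_on U) V W (VU : V `<=` U)
  (WU : W `<=` U) (WV : W `<=` V) x :
  om_res WV ((rs_res VU a \*: f V VU : {linear F V -> G V}) x) =
  (rs_res WU a \*: f W WU : {linear F W -> G W}) (om_res WV x).
Proof. by rewrite /= linearZ /= (hom_nat f VU WU) (rs_res_comp _ _ WU). Qed.
Definition hom_scale a f := HomOn (hom_scale_nat a f).

Fact hom_scaleA a b f : hom_scale a (hom_scale b f) = hom_scale (a * b) f.
Proof. by apply: hom_on_ext => V VU x /=; rewrite scalerA rmorphM. Qed.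
Fact hom_scale1 : left_id 1 hom_scale.
Proof. by move=> f; apply: hom_on_ext => V VU x /=; rewrite rmorph1 scale1r. Qed.
Fact hom_scaleDr : right_distributive hom_scale +%R.
Proof. by move=> a f g; apply: hom_on_ext => V VU x /=; rewrite scalerDr. Qed.
Fact hom_scaleDl f : {morph hom_scale^~ f : a b / a + b}.
Proof.
by move=> a b; apply: hom_on_ext => V VU x /=; rewrite rmorphD scalerDl.
Qed.

HB.instance Definition _ := GRing.Zmodule_isLmodule.Build
  (rs_ring U) (hom_on U) hom_scaleA hom_scale1 hom_scaleDr hom_scaleDl.

End Module.

Definition hom_res (U V : opens X) (VU : V `<=` U) (f : hom_on U) : hom_on V :=
  @HomOn V (fun W WV => f W (subset_trans WV VU))
    (fun W W' WV W'V => hom_nat f (subset_trans WV VU) (subset_trans W'V VU)).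

Fact hom_res_linear U V (VU : V `<=` U) :
  linear_for (rs_res VU \; *:%R) (@hom_res U V VU).
Proof.
move=> a f g; apply: hom_on_ext => W WV x /=.
by rewrite (rs_res_comp VU WV (subset_trans WV VU)).
Qed.

HB.instance Definition _ U V (VU : V `<=` U) :=
  GRing.isLinear.Build _ _ _ _ _ (hom_res_linear VU).

Fact hom_res_id (U : opens X) (h : U `<=` U) f : hom_res h f = f.
Proof.
apply: hom_on_ext => V VU x /=.
by rewrite (Prop_irrelevance (subset_trans VU h) VU).
Qed.

Fact hom_res_comp (U V W : opens X)
  (VU : V `<=` U) (WV : W `<=` V) (WU : W `<=` U) f :
  hom_res WV (hom_res VU f) = hom_res WU f.
Proof.
apply: hom_on_ext => V' V'W x /=; congr (hom_fun _ _ _); exact: Prop_irrelevance.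
Qed.

Fact hom_sheaf_axiom : is_sheaf hom_res.
Proof.
move=> I U W WU cov s compat.
have compatE i j T (Ti : T `<=` W i) (Tj : T `<=` W j) (x : F T) :
    s i T Ti x = s j T Tj x.
  have := congr1 (fun f : hom_on T => f T (@subset_refl _ T) x) (compat i j T Ti Tj).
  rewrite /= (Prop_irrelevance (subset_trans _ Ti) Ti).
  by rewrite (Prop_irrelevance (subset_trans _ Tj) Tj).
pose glues V (x : F V) (y : G V) := forall i T (TV : T `<=` V)
  (Ti : T `<=` W i), om_res TV y = s i T Ti (om_res TV x).
have ex1 V (VU : V `<=` U) (x : F V) :
    exists2 y, glues V x y & forall y', glues V x y' -> y = y'.
  pose W' i := open_cap V (W i).
  have W'V i : W' i `<=` V by move=> z [].
  have W'W i : W' i `<=` W i by move=> z [].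
  have cov' : V `<=` \bigcup_i W' i.
    by move=> z Vz; have [i _ Wz] := cov _ (VU _ Vz); exists i.
  have [|y [yE yU]] := @om_sheaf X G I V W' W'V cov'
      (fun i => s i _ (W'W i) (om_res (W'V i) x)).
    move=> i j T Ti Tj.
    rewrite (hom_nat (s i) (W'W i) (subset_trans Ti (W'W i))).
    rewrite (hom_nat (s j) (W'W j) (subset_trans Tj (W'W j))).
    rewrite !(om_res_comp (W'V _) _ (subset_trans Ti (W'V i))).
    exact: compatE.
  exists y => [i T TV Ti|y' y'E].
    have Ti' : T `<=` W' i by move=> z Tz; split; [apply: TV|apply: Ti].
    rewrite -(om_res_comp (W'V i) Ti' TV) yE (hom_nat (s i) (W'W i) Ti).
    by rewrite (om_res_comp (W'V i) Ti' TV).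
  by apply: yU => i; exact: y'E.
have exL V (VU : V `<=` U) :
    exists f : {linear F V -> G V}, forall x, glues V x (f x).
  have /choice [f fP] : forall x, exists y, glues V x y.
    by move=> x; have [y yP _] := ex1 V VU x; exists y.
  have f_lin : linear f.
    move=> a x x'; have [y _ yU] := ex1 V VU (a *: x + x').
    rewrite -(yU (f (a *: x + x'))) ?(yU (a *: f x + f x')) // => i T TV Ti.
    by rewrite !linearP /= !(fP _ i T TV Ti).
  pose fL := GRing.isLinear.Build _ _ _ _ _ f_lin.
  pose g : {linear F V -> G V} := HB.pack f fL.
  by exists g => x; exact: fP.
pose t V (VU : V `<=` U) := sval (cid (exL V VU)).
have tP V (VU : V `<=` U) x : glues V x (t V VU x).
  exact: (svalP (cid (exL V VU))).
have t_nat V V' (VU : V `<=` U) (V'U : V' `<=` U) (V'V : V' `<=` V) x :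
    om_res V'V (t V VU x) = t V' V'U (om_res V'V x).
  have [y _ yU] := ex1 V' V'U (om_res V'V x).
  rewrite -(yU _ (tP V' V'U _)); apply/esym/yU => i T TV' Ti.
  rewrite (om_res_comp _ _ (subset_trans TV' V'V)) (tP V VU x i).
  by rewrite (om_res_comp _ _ (subset_trans TV' V'V)).
exists (HomOn t_nat); split=> [i|f fE].
  apply: hom_on_ext => V VW x /=.
  have := tP V (subset_trans VW (WU i)) x i V (@subset_refl _ V) VW.
  by rewrite !om_res_id.
apply: hom_on_ext => V VU x /=.
have [y _ yU] := ex1 V VU x.
rewrite -(yU _ (tP V VU x)); apply: yU => i T TV Ti.
by rewrite (hom_nat f VU (subset_trans Ti (WU i))) -fE /=.
Qed.

Definition hom_sheaf : omodule X :=
  @OModule X hom_on (fun U V VU => @hom_res U V VU)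
    hom_res_id hom_res_comp hom_sheaf_axiom.

End HomSheaf.

Section Dual.
Variable X : ringed_space.

Definition sheaf_dual (F : omodule X) : omodule X := hom_sheaf F (struct_sheaf X).

Variables (F G : omodule X) (f : omorphism F G).

Fact sheaf_dual_fun_nat (U : opens X) (u : hom_on G (struct_sheaf X) U)
    (V W : opens X) (VU : V `<=` U) (WU : W `<=` U) (WV : W `<=` V) x :
  om_res WV ((u V VU \o f V : {linear F V -> struct_sheaf X V}) x) =
  (u W WU \o f W : {linear F W -> struct_sheaf X W}) (om_res WV x).
Proof. by rewrite /= (hom_nat u VU WU) omor_nat. Qed.

Definition sheaf_dual_fun (U : opens X) (u : sheaf_dual G U) : sheaf_dual F U :=
  HomOn (sheaf_dual_fun_nat u).

Fact sheaf_dual_fun_linear U : linear (@sheaf_dual_fun U).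
Proof. by move=> a u v; apply: hom_on_ext => V VU x. Qed.

HB.instance Definition _ U :=
  GRing.isLinear.Build _ _ _ _ _ (@sheaf_dual_fun_linear U).

Fact sheaf_dual_map_nat (U V : opens X) (VU : V `<=` U) u :
  om_res VU (sheaf_dual_fun u) = sheaf_dual_fun (om_res VU u).
Proof. exact: hom_on_ext. Qed.

Definition sheaf_dual_map : omorphism (sheaf_dual G) (sheaf_dual F) :=
  @OMorphism X (sheaf_dual G) (sheaf_dual F) (fun U => @sheaf_dual_fun U)
    sheaf_dual_map_nat.

End Dual.

Section SheafLinkage.
Variable X : ringed_space.
Implicit Types A B C F G L N : omodule X.

Definition sheaf_exact A B C (f : omorphism A B) (g : omorphism B C) : Prop :=
  (forall (U : opens X) a, g U (f U a) = 0) /\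
  (forall (U : opens X) b, g U b = 0 ->
     locally_on (fun (V : opens X) (VU : V `<=` U) =>
       exists a, f V a = om_res VU b)).

Definition sheaf_epi A B (f : omorphism A B) : Prop :=
  forall (U : opens X) b,
    locally_on (fun (V : opens X) (VU : V `<=` U) =>
      exists a, f V a = om_res VU b).

(* L is a cokernel of f in the category of sheaves of modules: this determines
   L up to isomorphism, so it expresses that L is isomorphic to Coker f. *)
Definition sheaf_is_coker A B (f : omorphism A B) L : Prop :=
  exists p : omorphism B L,
    (forall (U : opens X) a, p U (f U a) = 0) /\
    (forall N (q : omorphism B N), (forall (U : opens X) a, q U (f U a) = 0) ->
       exists2 u : omorphism L N, (forall (U : opens X) b, u U (p U b) = q U b)
         & forall u' : omorphism L N,
             (forall (U : opens X) b, u' U (p U b) = q U b) ->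
             forall (U : opens X) z, u' U z = u U z).

Definition sheaf_presentation F (t1 t2 : nat)
    (phi : omorphism (free_sheaf X t2) (free_sheaf X t1))
    (vphi : omorphism (free_sheaf X t1) F) : Prop :=
  sheaf_exact phi vphi /\ sheaf_epi vphi.

End SheafLinkage.

(* The pair of ranks (t1, t2) is as small as possible: first t1 is minimal, and
   then t2 is. If both can be minimised independently, this yields that pair. *)
Definition least_ranks (P : nat -> nat -> Prop) (t1 t2 : nat) : Prop :=
  P t1 t2 /\
  forall s1 s2, P s1 s2 -> (t1 < s1)%N \/ (t1 = s1 /\ (t2 <= s2)%N).

Section SheafLambda.
Variable X : ringed_space.
Implicit Types F G L : omodule X.

Definition sheaf_presented F (t1 t2 : nat) : Prop :=
  exists (phi : omorphism (free_sheaf X t2) (free_sheaf X t1))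
         (vphi : omorphism (free_sheaf X t1) F),
    sheaf_presentation phi vphi.

(* L is isomorphic to lambda F, computed from some minimal presentation of F.
   Over a general base minimal presentations need not be unique. *)
Definition sheaf_is_lambda F L : Prop :=
  exists (t1 t2 : nat)
         (phi : omorphism (free_sheaf X t2) (free_sheaf X t1))
         (vphi : omorphism (free_sheaf X t1) F),
    [/\ sheaf_presentation phi vphi,
        least_ranks (sheaf_presented F) t1 t2
      & sheaf_is_coker (sheaf_dual_map vphi) L].

Definition sheaf_linked F G : Prop :=
  sheaf_is_lambda G F /\ sheaf_is_lambda F G.

End SheafLambda.

Section DualModule.
Variable R : comPzRingType.

Definition mod_dual (M : lmodType R) : Type := {linear M -> R^o}.

Section Instances.
Variable M : lmodType R.

HB.instance Definition _ := gen_eqMixin (mod_dual M).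
HB.instance Definition _ := gen_choiceMixin (mod_dual M).

Let zero : mod_dual M := \0.
Let opp (u : mod_dual M) : mod_dual M := \- u.
Let add (u v : mod_dual M) : mod_dual M := u \+ v.
Let scale (a : R) (u : mod_dual M) : mod_dual M := a \*: u.

Fact mod_dual_addA : associative add.
Proof. by move=> u v w; apply: linear_ext => x /=; rewrite addrA. Qed.
Fact mod_dual_addC : commutative add.
Proof. by move=> u v; apply: linear_ext => x /=; rewrite addrC. Qed.
Fact mod_dual_add0 : left_id zero add.
Proof. by move=> u; apply: linear_ext => x /=; rewrite add0r. Qed.
Fact mod_dual_addN : left_inverse zero opp add.
Proof. by move=> u; apply: linear_ext => x /=; rewrite addNr. Qed.

HB.instance Definition _ := GRing.isZmodule.Build (mod_dual M)
  mod_dual_addA mod_dual_addC mod_dual_add0 mod_dual_addN.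

Fact mod_dual_scaleA a b u : scale a (scale b u) = scale (a * b) u.
Proof. by apply: linear_ext => x /=; rewrite scalerA. Qed.
Fact mod_dual_scale1 : left_id 1 scale.
Proof. by move=> u; apply: linear_ext => x /=; rewrite scale1r. Qed.
Fact mod_dual_scaleDr : right_distributive scale +%R.
Proof. by move=> a u v; apply: linear_ext => x /=; rewrite scalerDr. Qed.
Fact mod_dual_scaleDl u : {morph scale^~ u : a b / a + b}.
Proof. by move=> a b; apply: linear_ext => x /=; rewrite scalerDl. Qed.

HB.instance Definition _ := GRing.Zmodule_isLmodule.Build R (mod_dual M)
  mod_dual_scaleA mod_dual_scale1 mod_dual_scaleDr mod_dual_scaleDl.

End Instances.

Variables (M N : lmodType R) (g : {linear M -> N}).

Definition mod_dual_map (u : mod_dual N) : mod_dual M :=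
  (u : {linear N -> R^o}) \o g.

Fact mod_dual_map_linear : linear mod_dual_map.
Proof. by move=> a u v; apply: linear_ext. Qed.

HB.instance Definition _ := GRing.isLinear.Build _ _ _ _ _ mod_dual_map_linear.

End DualModule.

Section ModuleLinkage.
Variable R : comPzRingType.
Implicit Types A B C L M N : lmodType R.

Definition mod_is_coker A B (f : {linear A -> B}) L : Prop :=
  exists p : {linear B -> L},
    (forall a, p (f a) = 0) /\
    (forall N (q : {linear B -> N}), (forall a, q (f a) = 0) ->
       exists2 u : {linear L -> N}, (forall b, u (p b) = q b)
         & forall u' : {linear L -> N}, (forall b, u' (p b) = q b) ->
             forall z, u' z = u z).

Definition mod_presentation M (t1 t2 : nat)
    (f : {linear 'rV[R]_t2 -> 'rV[R]_t1}) (g : {linear 'rV[R]_t1 -> M}) : Prop :=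
  [/\ forall x, g (f x) = 0,
      forall y, g y = 0 -> exists x, f x = y
    & forall z, exists y, g y = z].

Definition mod_presented M (t1 t2 : nat) : Prop :=
  exists (f : {linear 'rV[R]_t2 -> 'rV[R]_t1}) (g : {linear 'rV[R]_t1 -> M}),
    mod_presentation f g.

Definition mod_is_lambda M L : Prop :=
  exists (t1 t2 : nat)
         (f : {linear 'rV[R]_t2 -> 'rV[R]_t1}) (g : {linear 'rV[R]_t1 -> M}),
    [/\ mod_presentation f g,
        least_ranks (mod_presented M) t1 t2
      & mod_is_coker (mod_dual_map g : {linear mod_dual _ -> mod_dual _}) L].

Definition mod_linked M N : Prop := mod_is_lambda N M /\ mod_is_lambda M N.

End ModuleLinkage.

Section Coherent.
Variable X : ringed_space.

(* [P] stands for a subsheaf of the restriction of E to U. *)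
Definition finite_type_on (E : omodule X) (U : opens X)
    (P : forall V : opens X, V `<=` U -> set (E V)) : Prop :=
  locally_on (fun (V : opens X) (VU : V `<=` U) =>
    exists (n : nat) (s : 'I_n -> E V),
      (forall i, P V VU (s i)) /\
      (forall (W : opens X) (WV : W `<=` V) (t : E W),
         P W (subset_trans WV VU) t ->
         locally_on (fun (W' : opens X) (W'W : W' `<=` W) =>
           exists c : 'I_n -> rs_ring W',
             om_res W'W t =
             \sum_(i < n) c i *: om_res (subset_trans W'W WV) (s i)))).

(* E is of finite type, and so is the kernel of every morphism from a finite
   free sheaf to E over an open subset. *)
Definition coherent (E : omodule X) : Prop :=
  finite_type_on (fun (V : opens X) (_ : V `<=` open_full X) => @setT (E V)) /\
  forall (U : opens X) (n : nat) (s : 'I_n -> E U),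
    finite_type_on (E := free_sheaf X n) (fun (V : opens X) (VU : V `<=` U) =>
      [set c : 'rV[rs_ring V]_n |
        \sum_(i < n) c 0 i *: om_res VU (s i) = 0]).

End Coherent.

Section Spectrum.
Variable R : comPzRingType.

Definition is_ideal (I : set R) : Prop :=
  [/\ I 0, forall x y, I x -> I y -> I (x + y) & forall a x, I x -> I (a * x)].

Definition is_prime_ideal (P : set R) : Prop :=
  [/\ is_ideal P, ~ P 1 & forall x y, P (x * y) -> P x \/ P y].

Definition noetherian_ring : Prop :=
  forall I : set R, is_ideal I ->
    exists (n : nat) (g : 'I_n -> R),
      I = [set x | exists c : 'I_n -> R, x = \sum_(i < n) c i * g i].

Record spec := SpecPoint {
  spec_set :> set R;
  spec_prime : is_prime_ideal spec_set }.

HB.instance Definition _ := gen_eqMixin spec.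
HB.instance Definition _ := gen_choiceMixin spec.

Definition zariski_open (U : set spec) : Prop :=
  exists E : set R, U = [set p : spec | ~ E `<=` p].

Fact zariski_openT : zariski_open setT.
Proof.
exists setT; apply/seteqP; split=> p // _ h.
by case: (spec_prime p) => _ + _; apply; apply: h.
Qed.

Fact zariski_openI : setI_closed zariski_open.
Proof.
move=> _ _ [E ->] [E' ->]; exists [set x * y | x in E & y in E'].
apply/seteqP; split=> p.
  move=> [/existsNP [x /not_implyP [Ex px]] /existsNP [y /not_implyP [Ey py]]].
  move=> /(_ (x * y)) h.
  by case: (spec_prime p) => _ _ /(_ x y (h _)) [] //; exists x => //; exists y.
case: (spec_prime p) => -[_ _ pM] _ _ h.
split=> h'; apply: h => _ [x Ex [y Ey <-]]; last exact/pM/h'.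
by rewrite mulrC; apply/pM/h'.
Qed.

Fact zariski_open_bigU (I : Type) (f : I -> set spec) :
  (forall i, zariski_open (f i)) -> zariski_open (\bigcup_i f i).
Proof.
move=> /choice [E fE]; exists (\bigcup_i E i); apply/seteqP; split=> p.
  by move=> [i _]; rewrite fE => h h'; apply: h => x Ex; apply: h'; exists i.
move=> /existsNP [x /not_implyP [[i _ Ex] px]]; exists i => //.
by rewrite fE => /(_ x Ex).
Qed.

HB.instance Definition _ := isOpenTopological.Build spec
  zariski_openT zariski_openI zariski_open_bigU.

Definition basic_open (f : R) : set spec := [set p : spec | ~ spec_set p f].

End Spectrum.

(* [a] makes S the ring of fractions of R with denominators the powers of f. *)
Definition is_localization_away (R S : comPzRingType) (f : R)
    (a : {rmorphism R -> S}) : Prop :=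
  [/\ exists b, a f * b = 1,
      forall y, exists x n, y * a f ^+ n = a x
    & forall x x', a x = a x' -> exists n, f ^+ n * x = f ^+ n * x'].

(* The open subspace U of X is isomorphic to Spec R: the structure sheaf of
   Spec R is the sheaf of rings whose ring of sections over each basic open set
   D(f) is the localization of R at f. The homeomorphism [h] is from Spec R onto
   U, and [a] is the comorphism on global sections. *)
Definition is_spec_of (X : ringed_space) (U : opens X) (R : comPzRingType) :
    Prop :=
  exists (h : spec R -> X) (a : {rmorphism R -> rs_ring U}),
    [/\ continuous h, injective h, range h = U,
        forall V : set (spec R), open V -> open (h @` V)
      & forall (f : R) (V : opens X) (VU : V `<=` U),
          open_set V = h @` basic_open f ->
          is_localization_away f (rs_res VU \o a : {rmorphism R -> rs_ring V})].

Definition affine_scheme (X : ringed_space) : Prop :=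
  exists R : comPzRingType, is_spec_of (open_full X) R.

Definition noetherian_scheme (X : ringed_space) : Prop :=
  exists (n : nat) (U : 'I_n -> opens X) (R : 'I_n -> comPzRingType),
    (forall i, noetherian_ring (R i) /\ is_spec_of (U i) (R i)) /\
    [set: X] `<=` \bigcup_i U i.

(* Main.v *)
(* On the affine scheme X, a coherent sheaf E has E(D(s)) equal to the
   localisation of its global sections at s. Hence, for every sheaf of modules
   N, morphisms E -> N are the same as linear maps between global sections, and
   a global section that lies locally in the image of a morphism of such sheaves
   lies globally in its image: the scalars carrying it into the image form an
   ideal contained in no prime. So minimal presentations of a sheaf and of its
   module of global sections correspond.
   For a presentation O^t2 -> O^t1 -> G -> 0 the dual sequence
   G^* -> (O^t1)^* -> (O^t2)^* is exact. Testing the universality of a cokernel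
   (O^t1)^* -> L of G^* -> (O^t1)^* against the second arrow therefore shows that
   its kernel is G^*, and testing it against its own image sheaf shows that it
   is epi; no quotient sheaf has to be constructed. *)

From HB Require Import structures.
Require Import Defs.
From mathcomp Require Import all_boot all_order all_algebra.
From mathcomp Require Import all_classical topology.

Set Implicit Arguments.
Unset Strict Implicit.
Unset Printing Implicit Defensive.

Import GRing.Theory.
Local Open Scope classical_set_scope.
Local Open Scope ring_scope.

(** * Basic open sets of an affine scheme *)

Section Primes.
Variable R : comPzRingType.
Implicit Types (J : set R) (f : R).

Lemma ideal_mulr J x y : is_ideal J -> J x -> J (x * y).
Proof. by case=> _ _ JM Jx; rewrite mulrC; apply: JM. Qed.

(** An ideal maximal among those containing [J] and no power of [f] is prime. *)
Lemma prime_ideal_avoiding J f : is_ideal J -> (forall n, ~ J (f ^+ n)) ->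
  exists p : spec R, J `<=` p /\ ~ spec_set p f.
Proof.
move=> Jid Jf.
(* [Zorn_bigcup] also tests the empty chain, whose union is empty; adjoining [J] to [S] makes the
   empty set a member of [P]. *)
pose P := [set S : set R | is_ideal (S `|` J) /\ forall n, ~ (S `|` J) (f ^+ n)].
have [F FP Ftot|A [[Aid Af] Amax]] := @Zorn_bigcup R P.
  have [[S0 FS0]|F0] := pselect (exists S, F S); last first.
    suff -> : \bigcup_(S in F) S = set0 by rewrite /P /= set0U; split=> // n [//|/Jf].
    by apply/seteqP; split=> // x [S FS _]; case: F0; exists S.
  split; last first.
    move=> n [[S FS Sf]|]; last exact: Jf.
    by have [_ /(_ n)] := FP _ FS; apply; left.
  split.
  - by right; case: Jid.
  - move=> x y [[S FS Sx]|Jx] [[T FT Ty]|Jy].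
    + have [ST|TS] := Ftot _ _ FS FT.
        have [[_ + _] _] := FP _ FT.
        move=> /(_ x y (or_introl (ST _ Sx)) (or_introl Ty)) [?|]; [left|by right].
        by exists T.
      have [[_ + _] _] := FP _ FS.
      move=> /(_ x y (or_introl Sx) (or_introl (TS _ Ty))) [?|]; [left|by right].
      by exists S.
    + have [[_ + _] _] := FP _ FS.
      move=> /(_ x y (or_introl Sx) (or_intror Jy)) [?|]; [left|by right].
      by exists S.
    + have [[_ + _] _] := FP _ FT.
      move=> /(_ x y (or_intror Jx) (or_introl Ty)) [?|]; [left|by right].
      by exists T.
    + by right; case: Jid => _ + _; apply.
  - move=> a x [[S FS Sx]|Jx]; last by right; case: Jid => _ _; apply.
    have [[_ _ +] _] := FP _ FS.
    by move=> /(_ a x (or_introl Sx)) [?|]; [left; exists S|right].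
have [M0 MD MM] := Aid.
(* By maximality, enlarging the ideal by an outside element [x] brings in a power of [f]; two such
   powers multiply to one that contradicts [x * y] being inside. *)
have aux x : ~ (A `|` J) x -> exists n m r, (A `|` J) m /\ f ^+ n = m + r * x.
  move=> Mx; apply: contrapT => H.
  pose B := [set y | exists m r, (A `|` J) m /\ y = m + r * x].
  have MB y : (A `|` J) y -> B y by move=> My; exists y, 0; rewrite mul0r addr0.
  have BJ : B `|` J = B.
    by apply/seteqP; split=> y; [case=> // Jy; apply: MB; right|left].
  apply: (Amax B).
    split=> [y Ay|e]; first by apply: MB; left.
    by apply: Mx; left; apply: e; exists 0, 1; rewrite mul1r add0r.
  rewrite /P; red; rewrite BJ; split; last first.
    by move=> n [m [r [Mm e]]]; apply: H; exists n, m, r.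
  split; first exact: MB.
  - move=> _ _ [m [r [Mm ->]]] [m' [r' [Mm' ->]]]; exists (m + m'), (r + r').
    by split; [exact: MD|rewrite mulrDl addrACA].
  - move=> a _ [m [r [Mm ->]]]; exists (a * m), (a * r).
    by split; [exact: MM|rewrite mulrDr mulrA].
have pr : is_prime_ideal (A `|` J).
  split=> //; first by have := Af 0%N; rewrite expr0.
  move=> x y Mxy; apply: contrapT => /not_orP [/aux Hx /aux Hy].
  have [n [m [r [Mm e]]]] := Hx; have [n' [m' [r' [Mm' e']]]] := Hy.
  apply: (Af (n + n')%N); rewrite exprD e e' mulrDl.
  apply: (MD); first exact: ideal_mulr.
  rewrite mulrDr; apply: (MD); first exact: MM.
  by rewrite mulrACA; apply: MM.
exists (SpecPoint pr); split=> /=; first by move=> x; right.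
by have := Af 1%N; rewrite expr1.
Qed.

End Primes.

Lemma opens_ext (T : topologicalType) (U V : opens T) : U = V :> set T -> U = V.
Proof.
by case: U V => [U oU] [V oV] /= e; subst V; rewrite (Prop_irrelevance oU oV).
Qed.

Definition sub_full (X : ringed_space) (U : opens X) : U `<=` open_full X :=
  @subsetT _ U.
Arguments sub_full {X} U [t] _.

(* The basic open sets are indexed by global sections rather than by elements
   of the ring of which [X] is the spectrum. *)
Record affine_basis (X : ringed_space) := AffineBasis {
  bopen : rs_ring (open_full X) -> opens X;
  bopen1 : bopen 1 = open_full X;
  bopenM : forall f g, bopen (f * g) = open_cap (bopen f) (bopen g);
  bopen0 : forall x, ~ open_set (bopen 0) x;
  bopenD : forall f g, bopen (f + g) `<=` bopen f `|` bopen g;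
  bopen_basis : forall (U : opens X) x, open_set U x ->
    exists f, bopen f `<=` U /\ open_set (bopen f) x;
  bopen_ideal : forall (J : set (rs_ring (open_full X))) f, is_ideal J ->
    (forall z, open_set (bopen f) z ->
      exists g, J g /\ open_set (bopen g) z) -> exists n, J (f ^+ n);
  bopen_loc : forall f,
    is_localization_away f (rs_res (sub_full (bopen f))) }.

(** The global sections take the place of the ring [R]: the map [a] turns out to be bijective, and
    its inverse [b] transports the basic open sets. *)
Lemma affine_basis_exists (X : ringed_space) :
  affine_scheme X -> inhabited (affine_basis X).
Proof.
move=> [R [h [a [hcont hinj hrange hopen hloc]]]].
have obasic (r : R) : open (basic_open r).
  exists [set r]; apply/seteqP; split=> p /=; first by move=> pr /(_ r erefl).
  by move=> H pr; apply: H => _ ->.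
have basic1 : basic_open (1 : R) = setT.
  by apply/seteqP; split=> // p _; case: (spec_prime p).
have aE x : rs_res (@subset_refl _ _ : open_full X `<=` open_full X) (a x) = a x.
  exact: rs_res_id.
(* The basic open set of 1 is the whole spectrum, and inverting 1 changes nothing; so the
   localization property there makes [a] bijective. *)
have [|_ asurj ainj] := hloc 1 (open_full X) (@subset_refl _ _).
  by rewrite basic1 hrange.
have {}asurj y : exists x, a x = y.
  have [x [n]] := asurj y; rewrite /= !aE rmorph1 expr1n mulr1 => ->.
  by exists x.
have {}ainj : injective a.
  move=> x y e; have [|n] := ainj x y; first by rewrite /= !aE.
  by rewrite expr1n !mul1r.
have [b bK] := choice asurj.
have aK x : b (a x) = x by apply: ainj; rewrite bK.
have opb f : open (h @` basic_open (b f)) by apply/hopen/obasic.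
pose D f : opens X := Opens (opb f).
have hb r p : (h @` basic_open r) (h p) <-> ~ spec_set p r.
  by split=> [[q qr /hinj <-]|pr] //; exists p.
have hsurj z : exists p, h p = z.
  by have : range h z; [rewrite hrange|case=> p _ <-; exists p].
have b0 : b 0 = 0 by rewrite -(rmorph0 a) aK.
have b1 : b 1 = 1 by rewrite -(rmorph1 a) aK.
have bD f g : b (f + g) = b f + b g by apply: ainj; rewrite rmorphD !bK.
have bM f g : b (f * g) = b f * b g by apply: ainj; rewrite rmorphM !bK.
have bX f n : b (f ^+ n) = b f ^+ n by apply: ainj; rewrite rmorphXn /= !bK.
constructor; apply: (@AffineBasis X D).
- apply: opens_ext; rewrite /= b1 basic1; exact: hrange.
- move=> f g; apply: opens_ext; apply/seteqP; split=> z; have [p <-] := hsurj z.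
    move=> /hb; rewrite bM => pfg; have [[_ _ pM] _ _] := spec_prime p.
    by split; apply/hb => q; apply: pfg; [rewrite mulrC|]; apply: pM.
  move=> [/hb pf /hb pg]; apply/hb; rewrite bM.
  by have [_ _ pp] := spec_prime p; move=> /pp [].
- move=> z; have [p <-] := hsurj z; move=> /hb; apply; rewrite b0.
  by case: (spec_prime p) => -[].
- move=> f g z; have [p <-] := hsurj z; move=> /hb; rewrite bD => pfg.
  have [[_ pD _] _ _] := spec_prime p.
  apply: contrapT => /not_orP [H1 H2]; apply: pfg; apply: pD; apply: contrapT.
    by move=> H; apply: H1; apply/hb.
  by move=> H; apply: H2; apply/hb.
- move=> U z; have [p <-] := hsurj z => Up.
  have /continuousP/(_ _ (open_setP U)) [E eE] := hcont.
  have : (h @^-1` U) p by [].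
  rewrite eE => /existsNP [r /not_implyP [Er pr]].
  exists (a r); split; last by apply/hb; rewrite aK.
  move=> w; have [q <-] := hsurj w => /hb; rewrite aK => qr.
  have : (h @^-1` U) q by rewrite eE => /(_ _ Er).
  by [].
(* If [J] held no power of [f], a prime containing [J] and missing [f] would be a point of [D f]
   lying in no [D g] with [g] in [J]. *)
- move=> J f [J0 JD JM] H; apply: contrapT => /forallNP Jf.
  have [||p [Jp pf]] := @prime_ideal_avoiding R (a @^-1` J) (b f).
  + split=> [|x y|x y]; rewrite /preimage /= ?rmorph0 ?rmorphD ?rmorphM //.
      exact: JD.
    exact: JM.
  + by move=> n; rewrite /preimage /= -bX bK.
  have [|g [Jg /hb pg]] := H (h p); first exact/hb.
  by apply: pg; apply: Jp; rewrite /preimage /= bK.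
- move=> f; have [|H1 H2 H3] := hloc (b f) (D f) (sub_full _); first by [].
  split.
  + by have [c e] := H1; exists c; move: e; rewrite /= bK.
  + by move=> y; have [x [n e]] := H2 y; exists (a x), n; move: e; rewrite /= bK.
  + move=> x y e; have [|n /(congr1 a)] := H3 (b x) (b y); first by rewrite /= !bK.
    by rewrite !rmorphM rmorphXn /= !bK => ?; exists n.
Qed.

(* Global scalars acting on sections over open sets *)
Reserved Notation "a *| x" (at level 40, left associativity).

Section GlobalScaling.
Variable X : ringed_space.
Implicit Types (F G : omodule X) (U V W : opens X).

(** Letting global sections act over every open set keeps all denominators in one ring, whatever the
    open set. *)
Definition gsc F U (a : rs_ring (open_full X)) (x : F U) : F U :=
  rs_res (sub_full U) a *: x.

Local Notation "a *| x" := (gsc a x).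

Lemma gscA F U a b (x : F U) : a *| (b *| x) = (a * b) *| x.
Proof. by rewrite /gsc scalerA rmorphM. Qed.

Lemma gscC F U a b (x : F U) : a *| (b *| x) = b *| (a *| x).
Proof. by rewrite !gscA mulrC. Qed.

Lemma gsc1 F U (x : F U) : 1 *| x = x.
Proof. by rewrite /gsc rmorph1 scale1r. Qed.

Lemma gsc0l F U (x : F U) : 0 *| x = 0.
Proof. by rewrite /gsc rmorph0 scale0r. Qed.

Lemma gsc0r F U a : a *| (0 : F U) = 0.
Proof. by rewrite /gsc scaler0. Qed.

Lemma gscDl F U a b (x : F U) : (a + b) *| x = a *| x + b *| x.
Proof. by rewrite /gsc rmorphD scalerDl. Qed.

Lemma gscDr F U a (x y : F U) : a *| (x + y) = a *| x + a *| y.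
Proof. by rewrite /gsc scalerDr. Qed.

Lemma gscBr F U a (x y : F U) : a *| (x - y) = a *| x - a *| y.
Proof. by rewrite /gsc scalerBr. Qed.

Lemma gscZ F U a c (x : F U) : a *| (c *: x) = c *: (a *| x).
Proof. by rewrite /gsc !scalerA mulrC. Qed.

Lemma gsc_full F a (x : F (open_full X)) : a *| x = a *: x.
Proof. by rewrite /gsc rs_res_id. Qed.

Lemma om_resB F U V (VU : V `<=` U) (x y : F U) :
  om_res VU (x - y) = om_res VU x - om_res VU y.
Proof. by rewrite linearB. Qed.

Lemma om_resZ F U V (VU : V `<=` U) a (x : F U) :
  om_res VU (a *: x) = rs_res VU a *: om_res VU x.
Proof. by rewrite linearZ. Qed.

Lemma om_res_gsc F U V (VU : V `<=` U) a (x : F U) :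
  om_res VU (a *| x) = a *| om_res VU x.
Proof. by rewrite /gsc om_resZ (rs_res_comp _ VU (sub_full _)). Qed.

Lemma omor_gsc F G (p : omorphism F G) U a (x : F U) : p U (a *| x) = a *| p U x.
Proof. by rewrite /gsc linearZ. Qed.

Lemma gsc_expD F U a m n (x : F U) : a ^+ (m + n) *| x = a ^+ m *| (a ^+ n *| x).
Proof. by rewrite gscA exprD. Qed.

Lemma gsc_exp_eq0 F U a m n (x : F U) :
  (m <= n)%N -> a ^+ m *| x = 0 -> a ^+ n *| x = 0.
Proof. by move=> /subnK <- e; rewrite gsc_expD e gsc0r. Qed.

(** Both [x] and 0 glue the zero family over the open sets on which [x] vanishes. *)
Lemma sheaf_sep F U (x : F U) :
  (forall z, open_set U z ->
     exists V (VU : V `<=` U), open_set V z /\ om_res VU x = 0) ->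
  x = 0.
Proof.
move=> H; pose I := {V : opens X | exists VU : V `<=` U, om_res VU x = 0}.
have WU (i : I) : sval i `<=` U by case: (svalP i).
have [|i j V Vi Vj|t [_ tU]] := @om_sheaf X F I U (fun i => sval i) WU _ (fun=> 0).
- move=> z /H [V [VU [Vz e]]].
  by exists (exist _ V (ex_intro _ VU e)).
- by rewrite !linear0.
rewrite -(tU x) ?(tU 0) // => i; first by rewrite linear0.
by case: (svalP i) => VU; rewrite (Prop_irrelevance (WU i) VU).
Qed.

Lemma sheaf_sep_eq F U (x y : F U) :
  (forall z, open_set U z ->
     exists V (VU : V `<=` U), open_set V z /\ om_res VU x = om_res VU y) ->
  x = y.
Proof.
move=> H; apply/eqP; rewrite -subr_eq0; apply/eqP; apply: sheaf_sep => z /H.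
by move=> [V [VU [Vz e]]]; exists V, VU; rewrite om_resB e subrr.
Qed.

End GlobalScaling.

Notation "a *| x" := (gsc a x) : ring_scope.

(** Makes one exponent serve for a finite cover or for all coordinates of a free module. *)
Lemma uniform_bound (I : finType) (P : I -> nat -> Prop) :
  (forall i m n, (m <= n)%N -> P i m -> P i n) -> (forall i, exists n, P i n) ->
  exists n, forall i, P i n.
Proof.
move=> mono /choice [b Pb]; exists (\max_i b i) => i.
exact: mono (leq_bigmax _) (Pb i).
Qed.

(** * Localization over basic open sets and their quasi-compactness *)

Section Basis.
Variables (X : ringed_space) (B : affine_basis X).
Implicit Types (F G : omodule X) (U V W : opens X).
Local Notation D := (bopen B).

Lemma bopenM_l f g : D (f * g) `<=` D f.
Proof. by rewrite bopenM => z []. Qed.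

Lemma bopenM_r f g : D (f * g) `<=` D g.
Proof. by rewrite bopenM => z []. Qed.

Lemma bopenX f n : D f `<=` D (f ^+ n).
Proof.
elim: n => [|n IH]; first by rewrite expr0 bopen1.
by rewrite exprS bopenM => z Dz; split=> //; apply: IH.
Qed.

Lemma bopen_unit f V : V `<=` D f ->
  exists b : rs_ring V, b * rs_res (sub_full V) f = 1.
Proof.
move=> VD; have [[b e] _ _] := bopen_loc B f.
exists (rs_res VD b); rewrite -(rs_res_comp (sub_full (D f)) VD) -rmorphM.
by rewrite mulrC e rmorph1.
Qed.

Lemma gsc_inj F f V (x y : F V) : V `<=` D f -> f *| x = f *| y -> x = y.
Proof.
move=> /bopen_unit [b e] /(congr1 (fun z => b *: z)).
by rewrite /gsc !scalerA e !scale1r.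
Qed.

Lemma gsc_eq0 F f V (x : F V) : V `<=` D f -> f *| x = 0 -> x = 0.
Proof. by move=> VD e; apply: (gsc_inj VD); rewrite e gsc0r. Qed.

Lemma gsc_div F f V (x : F V) : V `<=` D f -> exists y, f *| y = x.
Proof.
move=> /bopen_unit [b e]; exists (b *: x).
by rewrite gscZ /gsc scalerA e scale1r.
Qed.

(** Quasi-compactness of [D f]: the [r] whose basic open set has a finite cover of the required kind
    form an ideal, so a power of [f] is among them, and [D f] lies in the basic open set of that
    power. *)
Lemma bopen_cover f (P : rs_ring (open_full X) -> Prop) :
  (forall z, open_set (D f) z -> exists g, P g /\ open_set (D g) z) ->
  exists n (g : 'I_n -> rs_ring (open_full X)),
    (forall i, P (g i)) /\ D f `<=` \bigcup_i D (g i).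
Proof.
move=> H; pose cov r (l : seq (rs_ring (open_full X))) :=
  (forall g, g \in l -> P g) /\
  (forall z, open_set (D r) z -> exists2 g, g \in l & open_set (D g) z).
have covJ : is_ideal [set r | exists l, cov r l].
  split.
  - by exists [::]; split=> // z /bopen0.
  - move=> x y [l [lP lD]] [l' [lP' lD']]; exists (l ++ l'); split=> [g|z].
      by rewrite mem_cat => /orP [/lP|/lP'].
    move=> /bopenD [/lD [g gl]|/lD' [g gl]] Dg; exists g => //.
      by rewrite mem_cat gl.
    by rewrite mem_cat gl orbT.
  - move=> a x [l [lP lD]]; exists l; split=> // z /bopenM_r; exact: lD.
have [|n [l [lP lD]]] := @bopen_ideal X B _ f covJ.
  move=> z /H [g [Pg Dg]]; exists g; split=> //.
  exists [:: g]; split=> [g'|w Dw]; first by rewrite inE => /eqP ->.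
  by exists g; rewrite ?inE.
exists (size l), (fun i => nth 0 l i); split=> [i|z /(@bopenX _ n) /lD [g gl Dg]].
  exact/lP/mem_nth.
have ig : (index g l < size l)%N by rewrite index_mem.
by exists (Ordinal ig); rewrite //= nth_index.
Qed.

(* Sections over [U] cut by [D s] are the localization at [s] of those over [U]. *)
Definition qc_on F U := forall s V (VU : V `<=` U), V = open_cap U (D s) ->
  (forall x : F U, om_res VU x = 0 -> exists n, s ^+ n *| x = 0) /\
  (forall y : F V, exists n (x : F U), om_res VU x = s ^+ n *| y).

(** [D f] cut by [D s] is [D (f * s)], so fractions with denominator [f * s] apply; over [D f] the
    factor [f] is invertible and drops out. *)
Lemma qc_bopen F f : qc_on F (open_full X) -> qc_on F (D f).
Proof.
move=> qF s V VU e.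
have VE : V = open_cap (open_full X) (D (f * s)).
  by rewrite e bopenM; apply: opens_ext; rewrite /= setTI.
have Vf n : V `<=` D (f ^+ n) by move=> z /VU /bopenX; apply.
have Df n : D f `<=` D (f ^+ n) by move=> z /bopenX; apply.
have DT : D f `<=` open_full X by [].
have DE : D f = open_cap (open_full X) (D f) by apply: opens_ext; rewrite /= setTI.
have [qD1 qD2] := qF f (D f) DT DE.
have VT : V `<=` open_full X by [].
have [qV1 qV2] := qF (f * s) V VT VE.
split=> [x ex|y].
  have [n [a ea]] := qD2 x.
  have [|m em] := qV1 a.
    by rewrite -(om_res_comp DT VU) ea om_res_gsc ex gsc0r.
  exists m; apply: (gsc_eq0 (Df n)); apply: (gsc_eq0 (Df m)).
  by rewrite [f ^+ n *| _]gscC -ea gscA -exprMn -om_res_gsc em linear0.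
have [n [a ea]] := qV2 y.
have [x ex] := gsc_div (om_res DT a) (Df n).
exists n, x; apply: (gsc_inj (Vf n)).
by rewrite -om_res_gsc ex gscA -exprMn -ea (om_res_comp _ _ VT).
Qed.

Lemma qc_free n : qc_on (free_sheaf X n) (open_full X).
Proof.
move=> s V VU e; have {e} : V = D s
  by rewrite e; apply: opens_ext; rewrite /= setTI.
move=> ?; subst V; have [_ l2 l3] := bopen_loc B s.
rewrite (Prop_irrelevance VU (sub_full _)).
split=> [x /rowP e|y].
  have [|i|k H] := @uniform_bound _ (fun i k => s ^+ k * x 0 i = 0).
  - by move=> i m k /subnK <- H; rewrite exprD -mulrA H mulr0.
  - have := e i; rewrite !mxE => {}e;
    have [|k] := l3 (x 0 i) 0; first by rewrite e rmorph0.
    by rewrite mulr0; exists k.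
  by exists k; rewrite gsc_full; apply/rowP => i; rewrite !mxE.
pose P i k := exists a,
  rs_res (sub_full (D s)) (s ^+ k) * y 0 i = rs_res (sub_full _) a.
have [|i|k /choice [a H]] := @uniform_bound _ P.
- move=> i m k /subnK <- [a ea]; exists (s ^+ (k - m) * a).
  by rewrite exprD !rmorphM -mulrA ea.
- by have [a [k ek]] := l2 (y 0 i); exists k, a; rewrite rmorphXn mulrC.
by exists k, (\row_i a i); apply/rowP => i; rewrite !mxE -H.
Qed.

End Basis.

(** * Coherent sheaves are quasi-coherent *)

Section Coherence.
Variables (X : ringed_space) (B : affine_basis X).
Implicit Types (F G : omodule X) (U V W : opens X).
Local Notation D := (bopen B).

(** The morphism from a free sheaf given by the sections [s], evaluated over [W]. *)
Definition lincomb F V n (s : 'I_n -> F V) W (WV : W `<=` V)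
    (c : free_sheaf X n W) : F W :=
  \sum_i (c : 'rV_n) 0 i *: om_res WV (s i).

Lemma lincomb_res F V n (s : 'I_n -> F V) W W' (WV : W `<=` V) (W'W : W' `<=` W)
    (W'V : W' `<=` V) c :
  om_res W'W (lincomb s WV c) = lincomb s W'V (om_res W'W c).
Proof.
rewrite /lincomb linear_sum; apply: eq_bigr => i _.
by rewrite om_resZ (om_res_comp _ _ W'V) mxE.
Qed.

Lemma lincomb_gsc F V n (s : 'I_n -> F V) W (WV : W `<=` V) a c :
  lincomb s WV (a *| c) = a *| lincomb s WV c.
Proof.
rewrite /lincomb {2}/gsc scaler_sumr; apply: eq_bigr => i _.
by rewrite !mxE scalerA.
Qed.

Lemma lincomb_rel F V n (s : 'I_n -> F V) m (k : 'I_m -> free_sheaf X n V)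
    W (WV : W `<=` V) d :
  (forall j, lincomb s (@subset_refl _ _) (k j) = 0) ->
  lincomb s WV (lincomb k WV d) = 0.
Proof.
move=> sk.
transitivity (\sum_j (d : 'rV_m) 0 j *:
    om_res WV (lincomb s (@subset_refl _ _) (k j))); last first.
  by rewrite big1 // => j _; rewrite sk linear0 scaler0.
under [RHS]eq_bigr => j _ do rewrite (lincomb_res _ _ _ WV) scaler_sumr.
rewrite exchange_big /=; apply: eq_bigr => i _.
rewrite summxE scaler_suml; apply: eq_bigr => j _.
by rewrite !mxE scalerA.
Qed.

(** Exactness over [V] of a sequence O^m -> O^n -> F -> 0, with local lifts taken on basic open sets
    so that denominators can be cleared. *)
Definition presented_on F V : Prop :=
  exists n (s : 'I_n -> F V) m (k : 'I_m -> free_sheaf X n V),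
  [/\ forall j, lincomb s (@subset_refl _ _) (k j) = 0,
      forall W (WV : W `<=` V) (t : F W) z, open_set W z ->
        exists f (DW : D f `<=` W) c, open_set (D f) z /\
          om_res DW t = lincomb s (subset_trans DW WV) c
    & forall W (WV : W `<=` V) c, lincomb s WV c = 0 ->
        forall z, open_set W z ->
        exists f (DW : D f `<=` W) d, open_set (D f) z /\
          om_res DW c = lincomb k (subset_trans DW WV) d].

(** Finite type provides generators near [z]; coherence, applied to the map they define, provides
    finitely many relations on a smaller open set. *)
Lemma coherent_presented F z : coherent F ->
  exists V, open_set V z /\ presented_on F V.
Proof.
move=> [Fgen Frel]; have [V0 [V0T [V0z [n [s [_ sgen]]]]]] := Fgen z Logic.I.
have [V [VV0 [Vz [m [k [sk kgen]]]]]] := Frel V0 n s z V0z.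
exists V; split=> //; exists n, (fun i => om_res VV0 (s i)), m, k.
have resE W (WV : W `<=` V) (WV0 : W `<=` V0) c :
    lincomb (fun i => om_res VV0 (s i)) WV c = lincomb s WV0 c.
  by apply: eq_bigr => i _; rewrite (om_res_comp _ _ WV0).
split.
- by move=> j; rewrite (resE _ _ VV0); exact: sk.
- move=> W WV t w Ww.
  have [W1 [W1W [W1w [c ec]]]] := sgen W (subset_trans WV VV0) t Logic.I w Ww.
  have [f [DW1 Dw]] := bopen_basis B W1w.
  have DW := subset_trans DW1 W1W.
  exists f, DW, (om_res DW1 (\row_i c i : free_sheaf X n W1)); split=> //.
  rewrite (resE _ _ (subset_trans (subset_trans DW1 W1W) (subset_trans WV VV0))).
  rewrite -(om_res_comp W1W DW1) ec linear_sum; apply: eq_bigr => i _.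
  by rewrite om_resZ !mxE (om_res_comp _ _
    (subset_trans (subset_trans DW1 W1W) (subset_trans WV VV0))).
- move=> W WV c ec w Ww.
  have [|W1 [W1W [W1w [d ed]]]] := kgen W WV c _ w Ww.
    by move: ec; rewrite (resE _ _ (subset_trans WV VV0)).
  have [f [DW1 Dw]] := bopen_basis B W1w.
  have DW := subset_trans DW1 W1W.
  exists f, DW, (om_res DW1 (\row_i d i : free_sheaf X m W1)); split=> //.
  rewrite -(om_res_comp W1W DW1) ed linear_sum; apply: eq_bigr => i _.
  by rewrite om_resZ !mxE (om_res_comp _ _ (subset_trans DW WV)).
Qed.

Lemma full_capE f V : V = D f -> V = open_cap (open_full X) (D f).
Proof. by move=> ->; apply: opens_ext; rewrite /= setTI. Qed.

Lemma cap_subE f V : D f `<=` V -> D f = open_cap V (D f).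
Proof.
move=> DV; apply: opens_ext; apply/seteqP; split=> [z Dz|z []//].
by split=> //; apply: DV.
Qed.

(* Sections over a basic open set on which a free sheaf maps onto F: a section
   dying on D t is killed by a power of t, because its lifts become relations
   there. *)
Lemma presented_torsion F V f t W (WD : W `<=` D f) (x : F (D f)) :
  presented_on F V -> D f `<=` V -> W = open_cap (D f) (D t) ->
  om_res WD x = 0 -> exists n, t ^+ n *| x = 0.
Proof.
move=> [n [s [m [k [sk gen rel]]]]] DV WE x0.
pose P h := exists (hf : D h `<=` D f) n, t ^+ n *| om_res hf x = 0.
have [|N [g [Pg fg]]] := @bopen_cover X B f P.
  move=> z /(gen _ DV x z) [h [hf [y [hz ey]]]]; exists h; split=> //; exists hf.
  have hV := subset_trans hf DV.
  (* [y] lifts [x] over [D h]. Once a power of [h * t] carries [y] into the span of the relations,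
     it kills [x] there, and the invertible [h] can be cancelled. *)
  pose Q := [set r | exists d, r *| y = lincomb k hV d].
  have Qid : is_ideal Q.
    split.
    - by exists 0; rewrite gsc0l /lincomb big1 // => i _; rewrite mxE scale0r.
    - move=> a b [d ed] [d' ed']; exists (d + d'); rewrite gscDl ed ed'.
      by rewrite /lincomb -big_split /=; apply: eq_bigr => i _; rewrite mxE scalerDl.
    - by move=> a b [d ed]; exists (a *| d); rewrite -gscA ed lincomb_gsc.
  have [|N [d ed]] := @bopen_ideal X B Q (h * t) Qid.
    move=> w; rewrite bopenM => -[hw tw].
    have HD : open_cap (D h) (D t) `<=` D h by move=> ? [].
    have HV := subset_trans HD hV.
    have HW : open_cap (D h) (D t) `<=` W by rewrite WE => v [/hf ? ?].
    have [||e [De [d [ew ed]]]] := rel (open_cap (D h) (D t)) HV (om_res HD y) _ w.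
    - rewrite -(lincomb_res _ hV) -[hV](Prop_irrelevance (subset_trans hf DV)).
      rewrite -ey (om_res_comp _ _ (subset_trans HD hf)).
      by rewrite -(om_res_comp WD HW) x0 linear0.
    - by split.
    have eh := subset_trans De HD; have eV := subset_trans De HV.
    (* Near [w] the lift [y] is a combination of relations with coefficients [d]. Scaling by
       [e ^+ a] makes the coefficients global, and quasi-coherence of the free sheaf over [D h]
       moves the equality from [D e] to [D h] at the cost of [e ^+ b]. *)
    have [_ q2] := @qc_free X B m e (D e) (sub_full _) (full_capE erefl).
    have [a [d' ed']] := q2 d.
    have [q1 _] := @qc_bopen X B _ h (@qc_free X B n) e (D e) eh (cap_subE eh).
    have [|b eb] := q1 (e ^+ a *| y - lincomb k hV (om_res (sub_full _) d')).
      rewrite om_resB om_res_gsc (lincomb_res _ _ _ eV) (om_res_comp _ _ (sub_full _)).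
      rewrite ed' lincomb_gsc -(om_res_comp HD De eh) ed.
      by rewrite (Prop_irrelevance (subset_trans De HV) eV) subrr.
    exists (e ^+ (b + a)); split; last exact: bopenX.
    exists (e ^+ b *| om_res (sub_full _) d'); rewrite lincomb_gsc gsc_expD.
    by apply/eqP; rewrite -subr_eq0 -gscBr eb.
  exists N; apply: (@gsc_eq0 X B _ (h ^+ N)); first exact: bopenX.
  rewrite gscA -exprMn ey -lincomb_gsc -[subset_trans _ _](Prop_irrelevance hV).
  by rewrite ed lincomb_rel.
have [|i|n0 H] := @uniform_bound _ (fun (i : 'I_N) n => exists gf : D (g i) `<=` D f,
    t ^+ n *| om_res gf x = 0).
- by move=> i a b ab [gf e]; exists gf; apply: gsc_exp_eq0 e.
- by have [gf [a e]] := Pg i; exists a, gf.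
exists n0; apply: sheaf_sep => z /fg [i _ gz]; have [gf e] := H i.
by exists (D (g i)), gf; rewrite om_res_gsc.
Qed.

(* The elements [r] such that [r y] extends form an ideal. *)
Lemma presented_extend F V f t W (WD : W `<=` D f) (y : F W) :
  presented_on F V -> D f `<=` V -> W = open_cap (D f) (D t) ->
  exists n (x : F (D f)), om_res WD x = t ^+ n *| y.
Proof.
move=> presF DV; rewrite -bopenM => WE; subst W.
have [n [s [m [k [sk gen rel]]]]] := presF.
pose Q := [set r | exists x : F (D f), om_res WD x = r *| y].
have Qid : is_ideal Q.
  split.
  - by exists 0; rewrite linear0 gsc0l.
  - by move=> a b [x ex] [x' ex']; exists (x + x'); rewrite linearD /= ex ex' gscDl.
  - by move=> a b [x ex]; exists (a *| x); rewrite om_res_gsc ex gscA.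
have WV := subset_trans WD DV.
have [|N [x ex]] := @bopen_ideal X B Q (f * t) Qid.
  (* Near [z] the section [y] is a combination of the generators; scaled by [h ^+ a], its
     coefficients become global and define a section over [D f]. It matches [h ^+ a *| y] on [D h],
     hence over all of [W] after a factor [h ^+ b], by torsion. *)
  move=> z /(gen _ WV y z) [h [hW [c [hz ec]]]].
  have [_ q2] := @qc_free X B n h (D h) (sub_full _) (full_capE erefl).
  have [a [c' ec']] := q2 c.
  pose x := lincomb s DV (om_res (sub_full _) c').
  have [||b eb] := @presented_torsion F V (f * t) h (D h) hW
      (h ^+ a *| y - om_res WD x) presF WV.
  - exact: (cap_subE hW).
  - rewrite om_resB om_res_gsc ec (om_res_comp _ _ (subset_trans hW WD)).
    rewrite (lincomb_res _ _ _ (subset_trans hW WV)) (om_res_comp _ _ (sub_full _)).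
    by rewrite ec' lincomb_gsc subrr.
  exists (h ^+ (b + a)); split; last exact: bopenX.
  exists (h ^+ b *| x); rewrite om_res_gsc gsc_expD.
  by apply/esym/eqP; rewrite -subr_eq0 -gscBr eb.
have [x' ex'] := @gsc_div X B F (f ^+ N) _ x (@bopenX X B f N).
exists N, x'; apply: (@gsc_inj X B _ (f ^+ N)).
  by move=> z /WD; exact: bopenX.
by rewrite -om_res_gsc ex' ex exprMn gscA.
Qed.

Lemma presented_qc F V f : presented_on F V -> D f `<=` V -> qc_on B F (D f).
Proof.
move=> presF DV s W WD WE; split=> [x|y].
  exact: presented_torsion presF DV WE.
exact: presented_extend presF DV WE.
Qed.

(** Finitely many basic open sets on which [F] is presented cover [X]; quasi-coherence on them and
    on their overlaps is glued. *)
Lemma coherent_qc F : coherent F -> qc_on B F (open_full X).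
Proof.
move=> cohF s V VT; rewrite -(full_capE (erefl (D s))) => VE; subst V.
(* Asked of all smaller basic open sets, because the overlaps [D (g i * g j)] need it too. *)
pose P h := forall g, D g `<=` D h -> qc_on B F (D g).
have [|N [g [Pg gT]]] := @bopen_cover X B 1 P.
  move=> z _; have [V [Vz presF]] := coherent_presented z cohF.
  have [h [hV hz]] := bopen_basis B Vz; exists h; split=> // g gh.
  exact: presented_qc presF (subset_trans gh hV).
have gcov (z : X) : exists i, open_set (D (g i)) z.
  by have [|i _ iz] := gT z; [rewrite bopen1|exists i].
have gsg i : D (g i * s) `<=` D (g i) by exact: bopenM_l.
have gss i : D (g i * s) `<=` D s by exact: bopenM_r.
have gsE i : D (g i * s) = open_cap (D (g i)) (D s) by exact: bopenM.
split=> [x x0|y].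
  have [|i|n H] := @uniform_bound _ (fun (i : 'I_N) n =>
      s ^+ n *| om_res (sub_full (D (g i))) x = 0).
  - by move=> i a b ab e; apply: gsc_exp_eq0 e.
  - have [q1 _] := Pg i _ (@subset_refl _ _) s _ (gsg i) (gsE i).
    apply: q1; rewrite (om_res_comp _ _ (sub_full _)).
    by rewrite -(om_res_comp VT (gss i)) x0 linear0.
  exists n; apply: sheaf_sep => z _; have [i iz] := gcov z.
  by exists (D (g i)), (sub_full _); rewrite om_res_gsc H.
have [|i|n exx] := @uniform_bound _ (fun (i : 'I_N) n =>
    exists x, om_res (gsg i) x = s ^+ n *| om_res (gss i) y).
- move=> i a b /subnK <- [x ex]; exists (s ^+ (b - a) *| x).
  by rewrite om_res_gsc ex gsc_expD.
- have [_ q2] := Pg i _ (@subset_refl _ _) s _ (gsg i) (gsE i).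
  by have [n [x ex]] := q2 (om_res (gss i) y); exists n, x.
pose x i := sval (cid (exx i)).
have Hx i : om_res (gsg i) (x i) = s ^+ n *| om_res (gss i) y := svalP (cid (exx i)).
have lij i j : D (g i * g j) `<=` D (g i) by exact: bopenM_l.
have rij i j : D (g i * g j) `<=` D (g j) by exact: bopenM_r.
(* On [D (g i * g j * s)] the local extensions [x i] and [x j] both restrict to [s ^+ n *| y]; so on
   [D (g i * g j)] a power of [s] makes them agree, and the multiples glue. *)
have [|[i j]|m Hm] := @uniform_bound _ (fun (ij : 'I_N * 'I_N) m =>
    s ^+ m *| (om_res (lij ij.1 ij.2) (x ij.1) - om_res (rij ij.1 ij.2) (x ij.2)) = 0).
- by move=> i a b ab e; apply: gsc_exp_eq0 e.
- have ijs : D (g i * g j * s) `<=` D (g i * g j) by exact: bopenM_l.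
  have [q1 _] := Pg i _ (lij i j) s _ ijs (bopenM B _ _).
  apply: q1 => /=; rewrite om_resB.
  have ti : D (g i * g j * s) `<=` D (g i * s).
    by rewrite !bopenM => z [[? ?] ?].
  have tj : D (g i * g j * s) `<=` D (g j * s).
    by rewrite !bopenM => z [[? ?] ?].
  have ts : D (g i * g j * s) `<=` D s by exact: bopenM_r.
  rewrite (om_res_comp _ _ (subset_trans ti (gsg i))).
  rewrite (om_res_comp _ _ (subset_trans tj (gsg j))).
  rewrite -(om_res_comp (gsg i) ti) -(om_res_comp (gsg j) tj) !Hx.
  by rewrite !om_res_gsc !(om_res_comp _ _ ts) subrr.
have [|i j V Vi Vj|X0 [HX0 _]] := @om_sheaf X F 'I_N (open_full X) (fun i => D (g i))
    (fun i => sub_full _) _ (fun i => s ^+ m *| x i).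
- by move=> z _; have [i iz] := gcov z; exists i.
- have Vij : V `<=` D (g i * g j).
    by rewrite bopenM => z Vz; split; [exact: Vi|exact: Vj].
  rewrite -(om_res_comp (lij i j) Vij) -(om_res_comp (rij i j) Vij) !om_res_gsc.
  rewrite -![_ *| om_res Vij _]om_res_gsc.
  suff -> : s ^+ m *| om_res (lij i j) (x i) = s ^+ m *| om_res (rij i j) (x j) by [].
  by apply/eqP; rewrite -subr_eq0 -gscBr (Hm (i, j)).
exists (m + n)%N, X0; apply: sheaf_sep_eq => z sz; have [i iz] := gcov z.
exists (D (g i * s)), (gss i); split; first by rewrite bopenM.
rewrite (om_res_comp _ _ (subset_trans (gsg i) (sub_full _))).
rewrite -(om_res_comp (sub_full _) (gsg i)) HX0 !om_res_gsc Hx.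
by rewrite gsc_expD.
Qed.

End Coherence.

(** * Morphisms out of a quasi-coherent sheaf *)

Section HomExtension.
Variables (X : ringed_space) (B : affine_basis X).
Implicit Types (E F G N : omodule X) (U V W : opens X).
Local Notation D := (bopen B).

Lemma qc_torsion E f (x : E (open_full X)) : qc_on B E (open_full X) ->
  om_res (sub_full (D f)) x = 0 -> exists n, f ^+ n *| x = 0.
Proof. by move=> /(_ f (D f) (sub_full _) (full_capE erefl)) [+ _]; apply. Qed.

Lemma qc_extend E f (y : E (D f)) : qc_on B E (open_full X) ->
  exists n (x : E (open_full X)), om_res (sub_full (D f)) x = f ^+ n *| y.
Proof. by move=> /(_ f (D f) (sub_full _) (full_capE erefl)) [_]; apply. Qed.

Lemma qc_fraction E U (x : E U) z : qc_on B E (open_full X) -> open_set U z ->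
  exists V (VU : V `<=` U) s (a : E (open_full X)),
  [/\ open_set V z, V `<=` D s & s *| om_res VU x = om_res (sub_full V) a].
Proof.
move=> qE Uz; have [f [DU fz]] := bopen_basis B Uz.
have [n [a ea]] := qc_extend (om_res DU x) qE.
by exists (D f), DU, (f ^+ n), a; split=> //; exact: bopenX.
Qed.

Lemma ring_fraction U (c : rs_ring U) z : open_set U z ->
  exists V (VU : V `<=` U) s a,
  [/\ open_set V z, V `<=` D s
    & rs_res (sub_full V) s * rs_res VU c = rs_res (sub_full V) a].
Proof.
move=> Uz; have [f [DU fz]] := bopen_basis B Uz.
have [_ l2 _] := bopen_loc B f; have [a [n ea]] := l2 (rs_res DU c).
exists (D f), DU, (f ^+ n), a; split=> //; first exact: bopenX.
by rewrite rmorphXn mulrC.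
Qed.

Section Extend.
Variables (E N : omodule X) (qE : qc_on B E (open_full X)).
Variable u0 : {linear E (open_full X) -> N (open_full X)}.

(** Where [a] vanishes on [D f], a power of [f] kills it, hence kills [u0 a] by linearity. *)
Lemma linear_vanish V (a : E (open_full X)) :
  om_res (sub_full V) a = 0 -> om_res (sub_full V) (u0 a) = 0.
Proof.
move=> a0; apply: sheaf_sep => z Vz; have [f [DV fz]] := bopen_basis B Vz.
exists (D f), DV; split=> //; rewrite (om_res_comp _ _ (sub_full _)).
have [|n en] := @qc_torsion E f a qE.
  by rewrite -(om_res_comp (sub_full V) DV) a0 linear0.
apply: (@gsc_eq0 X B _ (f ^+ n)); first exact: bopenX.
by rewrite -om_res_gsc gsc_full -linearZ -gsc_full en !linear0.
Qed.

(* The value of the extension at [x] is forced by the ways of writing [x]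
   locally as a fraction [a / s] with [a] a global section. *)
Definition extends_at U (x : E U) (y : N U) :=
  forall V (VU : V `<=` U) s a, V `<=` D s ->
    s *| om_res VU x = om_res (sub_full V) a ->
    s *| om_res VU y = om_res (sub_full V) (u0 a).

(** [y'] need only be tested on one fraction near each point, since its denominator is invertible
    there; linearity and naturality of the extension are checked this way. *)
Lemma extends_at_unique U (x : E U) (y y' : N U) : extends_at x y ->
  (forall z, open_set U z -> exists V (VU : V `<=` U) s a,
    [/\ open_set V z, V `<=` D s, s *| om_res VU x = om_res (sub_full V) a
      & s *| om_res VU y' = om_res (sub_full V) (u0 a)]) -> y = y'.
Proof.
move=> xy H; apply: sheaf_sep_eq => z /H [V [VU [s [a [Vz Vs ex ey]]]]].
by exists V, VU; split=> //; apply: (gsc_inj Vs); rewrite ey; apply: xy.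
Qed.

(** The index set consists of all ways to write [x] on an open set as [a / s]; the quotients of
    [u0 a] by [s] are glued. *)
Lemma extends_at_exists U (x : E U) : exists y, extends_at x y.
Proof.
pose fraction (p : opens X * rs_ring (open_full X) * E (open_full X)) :=
  exists VU : p.1.1 `<=` U,
    p.1.1 `<=` D p.1.2 /\ p.1.2 *| om_res VU x = om_res (sub_full _) p.2.
pose I := {p | fraction p}.
pose V (i : I) := (sval i).1.1; pose s (i : I) := (sval i).1.2.
pose a (i : I) := (sval i).2.
have VU i : V i `<=` U by case: (svalP i).
have Vs i : V i `<=` D (s i) by case: (svalP i) => ? [].
have xa i : s i *| om_res (VU i) x = om_res (sub_full _) (a i).
  by case: (svalP i) => ? [_ e]; rewrite -e; congr (_ *| om_res _ _).
have divP i := gsc_div (om_res (sub_full _) (u0 (a i))) (Vs i).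
pose y i := sval (cid (divP i)).
have ya i : s i *| y i = om_res (sub_full _) (u0 (a i)) := svalP (cid (divP i)).
have [|i j W Wi Wj|t [tE _]] := @om_sheaf X N I U V VU _ y.
- move=> z Uz; have [V' [VU' [s' [a' [Vz Vs' e]]]]] := qc_fraction x qE Uz.
  have fP : fraction (V', s', a') by exists VU'.
  by exists (exist _ _ fP).
(* Clearing both denominators leaves [u0] of the difference of [s j *: a i] and [s i *: a j], whose
   argument vanishes on [W]. *)
- have Wsi : W `<=` D (s i) := subset_trans Wi (Vs i).
  have Wsj : W `<=` D (s j) := subset_trans Wj (Vs j).
  have WU := subset_trans Wi (VU i).
  apply: (gsc_inj Wsi); apply: (gsc_inj Wsj); rewrite [RHS]gscC -!om_res_gsc.
  rewrite !ya -!om_res_gsc !(om_res_comp _ _ (sub_full W)) !gsc_full -!linearZ.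
  rewrite -!gsc_full; apply/eqP; rewrite -subr_eq0 -om_resB -linearB.
  apply/eqP; apply: linear_vanish.
  rewrite om_resB !om_res_gsc -(om_res_comp (sub_full _) Wi) -xa.
  rewrite -(om_res_comp (sub_full _) Wj) -xa !om_res_gsc.
  by rewrite !(om_res_comp _ _ WU) gscC subrr.
exists t => W WU s' a' Ws' e.
have fP : fraction (W, s', a') by exists WU.
have := ya (exist _ _ fP); rewrite -tE => <-.
by congr (_ *| om_res _ _).
Qed.

Lemma hom_extension : exists u : omorphism E N,
  forall x, u (open_full X) x = u0 x.
Proof.
pose u U x := sval (cid (@extends_at_exists U x)).
have uP U x : extends_at x (u U x) := svalP (cid (extends_at_exists x)).
have u_lin U : linear (u U).
  move=> c x x'; apply: (extends_at_unique (uP _ _)) => z Uz.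
  have [V1 [VU1 [s1 [a1 [Vz1 Vs1 e1]]]]] := qc_fraction x qE Uz.
  have [V2 [VU2 [s2 [a2 [Vz2 Vs2 e2]]]]] := qc_fraction x' qE Uz.
  have [V3 [VU3 [s3 [a3 [Vz3 Vs3 e3]]]]] := ring_fraction c Uz.
  pose V := open_cap (open_cap V1 V2) V3.
  have V11 : V `<=` V1 by move=> w [[]].
  have V22 : V `<=` V2 by move=> w [[]].
  have V33 : V `<=` V3 by move=> w [].
  have VU : V `<=` U by apply: subset_trans V11 VU1.
  have res1 : s1 *| om_res VU x = om_res (sub_full V) a1.
    by rewrite -(om_res_comp VU1 V11) -om_res_gsc e1 (om_res_comp _ _ (sub_full _)).
  have res2 : s2 *| om_res VU x' = om_res (sub_full V) a2.
    by rewrite -(om_res_comp VU2 V22) -om_res_gsc e2 (om_res_comp _ _ (sub_full _)).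
  have res3 : rs_res (sub_full V) s3 * rs_res VU c = rs_res (sub_full V) a3.
    rewrite -(rs_res_comp VU3 V33) -(rs_res_comp (sub_full V3) V33) -rmorphM e3.
    by rewrite (rs_res_comp _ _ (sub_full _)).
  (* Stated for any sheaf because it serves twice: in [E] it writes [c *: x + x'] over the common
     denominator, in [N] it treats the images in the same way. *)
  have comb (F : omodule X) (y y' : F U) (b1 b2 : F (open_full X)) :
      s1 *| om_res VU y = om_res (sub_full V) b1 ->
      s2 *| om_res VU y' = om_res (sub_full V) b2 ->
      s1 * s2 * s3 *| om_res VU (c *: y + y') =
      om_res (sub_full V) (s2 * a3 *: b1 + s1 * s3 *: b2).
    move=> h1 h2; rewrite [in RHS]linearD -!gsc_full !om_res_gsc -h1 -h2.
    rewrite linearD om_resZ gscDr !gscA; congr (_ + _).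
      rewrite gscZ /gsc !scalerA; congr (_ *: _).
      by rewrite !rmorphM -res3 mulrC [RHS]mulrC -!mulrA.
    by congr (_ *| _); rewrite mulrAC.
  exists V, VU, (s1 * s2 * s3), (s2 * a3 *: a1 + s1 * s3 *: a2); split=> //.
  - by rewrite !bopenM => w [[/Vs1 ? /Vs2 ?] /Vs3 ?].
  - exact: comb.
  - have -> : u0 (s2 * a3 *: a1 + s1 * s3 *: a2) =
        s2 * a3 *: u0 a1 + s1 * s3 *: u0 a2 by rewrite linearD !linearZ.
    apply: comb; apply: uP => //.
      exact: subset_trans V11 Vs1.
    exact: subset_trans V22 Vs2.
pose uL U : {linear E U -> N U} :=
  HB.pack (u U) (GRing.isLinear.Build _ _ _ _ _ (u_lin U)).
have u_nat U V (VU : V `<=` U) x : om_res VU (uL U x) = uL V (om_res VU x).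
  apply/esym/(extends_at_unique (uP _ _)) => z Vz.
  have [W [WV [s [a [Wz Ws e]]]]] := qc_fraction (om_res VU x) qE Vz.
  exists W, WV, s, a; split=> //.
  have WU := subset_trans WV VU.
  rewrite (om_res_comp _ _ WU); apply: uP => //.
  by rewrite -(om_res_comp VU WV).
exists (OMorphism u_nat) => x /=; apply: (extends_at_unique (uP _ _)) => z _.
exists (open_full X), (sub_full _), 1, x; split=> //; first by rewrite bopen1.
  by rewrite gsc1.
by rewrite gsc1.
Qed.

End Extend.

Lemma hom_on_unique E N U (u v : hom_on E N U) :
  qc_on B E (open_full X) ->
  (forall V (VU : V `<=` U) a,
     u V VU (om_res (sub_full V) a) = v V VU (om_res (sub_full V) a)) ->
  u = v.
Proof.
move=> qE H; apply: hom_on_ext => V VU x; apply: sheaf_sep_eq => z Vz.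
have [W [WV [s [a [Wz Ws e]]]]] := qc_fraction x qE Vz.
exists W, WV; split=> //; apply: (gsc_inj Ws).
have WU := subset_trans WV VU.
by rewrite !(hom_nat _ VU WU) /gsc -!linearZ -/(gsc s _) e H.
Qed.

Definition omor_on E N (u : omorphism E N) U : hom_on E N U :=
  @HomOn X E N U (fun V _ => u V) (fun V W _ _ WV x => omor_nat u WV x).

Lemma omor_unique E N (u v : omorphism E N) : qc_on B E (open_full X) ->
  (forall x, u (open_full X) x = v (open_full X) x) ->
  forall U x, u U x = v U x.
Proof.
move=> qE H U x.
suff /(congr1 (fun w : hom_on E N U => w U (@subset_refl _ _) x)) :
  omor_on u U = omor_on v U by [].
by apply: hom_on_unique => // V VU a /=; rewrite -!omor_nat H.
Qed.

Lemma hom_full_unique E N (u v : hom_on E N (open_full X)) :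
  qc_on B E (open_full X) ->
  (forall x, u _ (@subset_refl _ _) x = v _ (@subset_refl _ _) x) -> u = v.
Proof.
move=> qE H; apply: hom_on_unique => // V VU a.
by rewrite -!(hom_nat _ (@subset_refl _ _)) H.
Qed.

End HomExtension.

(** * Images of morphisms *)

Section Image.
Variables (X : ringed_space) (E F : omodule X) (p : omorphism E F).
Implicit Types U V W : opens X.

(** Asking for preimages only locally makes these sections form a sheaf, without sheafification. *)
Definition locally_in_image U (x : F U) : Prop :=
  locally_on (fun (V : opens X) (VU : V `<=` U) => exists a, p V a = om_res VU x).

Lemma locally_in_image_res U V (VU : V `<=` U) (x : F U) :
  locally_in_image x -> locally_in_image (om_res VU x).
Proof.
move=> px z Vz; have [W [WU [Wz [a ea]]]] := px z (VU _ Vz).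
have CW : open_cap V W `<=` W by move=> w [].
have CV : open_cap V W `<=` V by move=> w [].
exists (open_cap V W), CV; split; first by split.
exists (om_res CW a); rewrite -omor_nat ea (om_res_comp _ _ (subset_trans CW WU)).
by rewrite (om_res_comp _ _ (subset_trans CW WU)).
Qed.

Definition image_pred U : {pred F U} := fun x => `[< locally_in_image x >].

Fact image_submod U : submod_closed (@image_pred U).
Proof.
split=> [|c x y /asboolP px /asboolP py]; apply/asboolP => z Uz.
  exists U, (@subset_refl _ _); split=> //.
  by exists 0; rewrite !linear0.
have [V [VU [Vz [a ea]]]] := px z Uz; have [W [WU [Wz [b eb]]]] := py z Uz.
have CV : open_cap V W `<=` V by move=> w [].
have CW : open_cap V W `<=` W by move=> w [].
have CU := subset_trans CV VU.
exists (open_cap V W), CU; split; first by split.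
exists (rs_res CU c *: om_res CV a + om_res CW b).
rewrite [LHS]linearP [RHS]linearD om_resZ -!omor_nat ea eb.
by rewrite !(om_res_comp _ _ CU).
Qed.

HB.instance Definition _ U :=
  GRing.isSubmodClosed.Build (rs_ring U) (F U) (@image_pred U) (@image_submod U).

Record image_sec U := ImageSec {
  image_val :> F U;
  image_valP : image_val \in @image_pred U }.

HB.instance Definition _ U := [isSub for @image_val U].
HB.instance Definition _ U := [Choice of image_sec U by <:].
HB.instance Definition _ U := [SubChoice_isSubLmodule of image_sec U by <:].

Lemma image_secP U (x : image_sec U) : locally_in_image (image_val x).
Proof. exact/asboolP/(image_valP x). Qed.

Definition image_mk U (x : F U) (px : locally_in_image x) : image_sec U :=
  ImageSec (asboolT px : x \in @image_pred U).

Lemma image_sec_inj U (x y : image_sec U) : image_val x = image_val y -> x = y.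
Proof. exact: val_inj. Qed.

Definition image_res U V (VU : V `<=` U) (x : image_sec U) : image_sec V :=
  image_mk (locally_in_image_res VU (image_secP x)).

Fact image_res_linear U V (VU : V `<=` U) :
  linear_for (rs_res VU \; *:%R) (@image_res U V VU).
Proof. by move=> c x y; apply: image_sec_inj; rewrite /= linearP. Qed.

HB.instance Definition _ U V (VU : V `<=` U) :=
  GRing.isLinear.Build _ _ _ _ _ (image_res_linear VU).

Fact image_res_id (U : opens X) (h : U `<=` U) x : image_res h x = x.
Proof. by apply: image_sec_inj; rewrite /= om_res_id. Qed.

Fact image_res_comp U V W (VU : V `<=` U) (WV : W `<=` V) (WU : W `<=` U) x :
  image_res WV (image_res VU x) = image_res WU x.
Proof. by apply: image_sec_inj; rewrite /= (om_res_comp _ _ WU). Qed.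

Fact image_sheaf_axiom : is_sheaf image_res.
Proof.
move=> I U W WU cov s compat.
have [|t [tE tU]] := @om_sheaf X F I U W WU cov (fun i => image_val (s i)).
  by move=> i j V Vi Vj; have /(congr1 (@image_val V)) := compat i j V Vi Vj.
have pt : locally_in_image t.
  move=> z Uz; have [i _ iz] := cov z Uz.
  have [V [Vi [Vz [a ea]]]] := image_secP (s i) iz.
  exists V, (subset_trans Vi (WU i)); split=> //; exists a.
  by rewrite ea -tE (om_res_comp _ _ (subset_trans Vi (WU i))).
exists (image_mk pt); split=> [i|t' Ht'].
  by apply: image_sec_inj; rewrite /= tE.
by apply: image_sec_inj; apply: tU => i; rewrite -Ht'.
Qed.

Definition image_sheaf : omodule X :=
  @OModule X image_sec (fun U V VU => @image_res U V VU)
    image_res_id image_res_comp image_sheaf_axiom.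

Fact image_incl_nat U V (VU : V `<=` U) (x : image_sheaf U) :
  om_res VU (image_val x) = image_val (om_res VU x).
Proof. by []. Qed.

Fact image_val_linear U : linear (@image_val U).
Proof. by []. Qed.

HB.instance Definition _ U :=
  GRing.isLinear.Build _ _ _ _ _ (@image_val_linear U).

Definition image_incl : omorphism image_sheaf F :=
  @OMorphism X image_sheaf F (fun U => @image_val U) image_incl_nat.

Fact omor_in_image U (a : E U) : locally_in_image (p U a).
Proof.
move=> z Uz; exists U, (@subset_refl _ _); split=> //.
by exists a; rewrite om_res_id.
Qed.

Definition image_proj_fun U (a : E U) : image_sheaf U := image_mk (omor_in_image a).

Fact image_proj_linear U : linear (@image_proj_fun U).
Proof. by move=> c x y; apply: image_sec_inj; rewrite /= linearP. Qed.

HB.instance Definition _ U :=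
  GRing.isLinear.Build _ _ _ _ _ (@image_proj_linear U).

Fact image_proj_nat U V (VU : V `<=` U) (a : E U) :
  om_res VU (image_proj_fun a) = image_proj_fun (om_res VU a).
Proof. by apply: image_sec_inj; rewrite /= omor_nat. Qed.

Definition image_proj : omorphism E image_sheaf :=
  @OMorphism X E image_sheaf (fun U => @image_proj_fun U) image_proj_nat.

End Image.

(** * Composition of morphisms, and cokernel projections *)

Section Composition.
Variable X : ringed_space.
Implicit Types A E F G L N : omodule X.

Fact omor_comp_nat E F G (q : omorphism F G) (p : omorphism E F)
    (U V : opens X) (VU : V `<=` U) x :
  om_res VU ((q U \o p U : {linear E U -> G U}) x) =
  (q V \o p V : {linear E V -> G V}) (om_res VU x).
Proof. by rewrite /= !omor_nat. Qed.

Definition omor_comp E F G (q : omorphism F G) (p : omorphism E F) :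
  omorphism E G := OMorphism (omor_comp_nat q p).

Fact omor_id_nat E (U V : opens X) (VU : V `<=` U) x :
  om_res VU ((idfun : {linear E U -> E U}) x) =
  (idfun : {linear E V -> E V}) (om_res VU x).
Proof. by []. Qed.

Definition omor_id E : omorphism E E := OMorphism (@omor_id_nat E).

(* The cokernel projection corestricts to its image sheaf, so by universality
   the inclusion of the image is a split epimorphism. *)
Lemma coker_epi E L (p : omorphism E L) :
  (forall N (q : omorphism E N),
     (forall (U : opens X) x, p U x = 0 -> q U x = 0) ->
     exists u : omorphism L N, forall (U : opens X) x, u U (p U x) = q U x) ->
  (forall u : omorphism L L,
     (forall (U : opens X) x, u U (p U x) = p U x) ->
     forall (U : opens X) z, u U z = z) ->
  sheaf_epi p.
Proof.
move=> fact uniq U b.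
have [|u uE] := fact _ (image_proj p).
  by move=> V x px0; apply: image_sec_inj.
have <- : image_val (u U b) = b.
  apply: (uniq (omor_comp (image_incl p) u)) => V x.
  by rewrite /= uE.
exact: image_secP.
Qed.

End Composition.

(** * Lifting global sections through a morphism; duals of free sheaves *)

Section GlobalImage.
Variables (X : ringed_space) (B : affine_basis X).
Implicit Types (E F G N : omodule X) (U V W : opens X).
Local Notation D := (bopen B).

Lemma global_image E F (p : omorphism E F) (b : F (open_full X)) :
  qc_on B E (open_full X) -> qc_on B F (open_full X) ->
  locally_in_image p b -> exists a, p _ a = b.
Proof.
move=> qE qF pb.
pose Q := [set r : rs_ring (open_full X) | exists a, p (open_full X) a = r *| b].
have Qid : is_ideal Q.
  split.
  - by exists 0; rewrite linear0 gsc0l.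
  - by move=> r r' [a ea] [a' ea']; exists (a + a'); rewrite linearD ea ea' gscDl.
  - by move=> r r' [a ea]; exists (r *| a); rewrite omor_gsc ea gscA.
have [|n] := @bopen_ideal X B Q 1 Qid; last first.
  by rewrite expr1n => -[a]; rewrite gsc1; exists a.
move=> z _; have [V [VT [Vz [a ea]]]] := pb z Logic.I.
have [f [DV fz]] := bopen_basis B Vz.
(* On [D f] the section [a] is a preimage of [b]. The multiple [f ^+ n *| a] extends to a global
   [a'], and [f ^+ m] kills the remaining difference, so [f ^+ (m + n)] lies in [Q]. *)
have [n [a' ea']] := qc_extend (om_res DV a) qE.
have [|m em] := @qc_torsion X B F f (p _ a' - f ^+ n *| b) qF.
  rewrite om_resB om_res_gsc omor_nat ea' omor_gsc -omor_nat ea.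
  by rewrite (om_res_comp _ _ (sub_full _)) subrr.
exists (f ^+ (m + n)); split; last exact: bopenX.
exists (f ^+ m *| a'); rewrite omor_gsc gsc_expD.
by apply/eqP; rewrite -subr_eq0 -gscBr em.
Qed.

Lemma qc_struct : qc_on B (struct_sheaf X) (open_full X).
Proof.
move=> s V VU e; have {e} : V = D s by rewrite e -(full_capE (erefl (D s))).
move=> ?; subst V; have [_ l2 l3] := bopen_loc B s.
rewrite (Prop_irrelevance VU (sub_full _)); split=> [x x0|y].
  have [|n] := l3 x 0; first by rewrite rmorph0.
  by rewrite mulr0; exists n; rewrite gsc_full.
have [a [n ea]] := l2 y; exists n, a.
by rewrite /gsc rmorphXn; apply: etrans (esym ea) _; rewrite mulrC.
Qed.

Lemma gsc_hom E F U a (u : hom_sheaf E F U) V (VU : V `<=` U) x :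
  hom_fun (a *| u) VU x = a *| hom_fun u VU x.
Proof. by rewrite /gsc /= (rs_res_comp _ _ (sub_full _)). Qed.

Definition unit_sec n U (i : 'I_n) : free_sheaf X n U := delta_mx 0 i : 'rV_n.

Lemma unit_sec_res n U V (VU : V `<=` U) i :
  om_res VU (unit_sec U i) = unit_sec V i :> free_sheaf X n V.
Proof. by rewrite /= /free_res map_delta_mx. Qed.

Lemma free_hom_unique n G U (u v : hom_on (free_sheaf X n) G U) :
  (forall i, u U (@subset_refl _ _) (unit_sec U i) =
             v U (@subset_refl _ _) (unit_sec U i)) -> u = v.
Proof.
move=> H; apply: hom_on_ext => V VU x.
rewrite [x]row_sum_delta !linear_sum; apply: eq_bigr => i _.
rewrite !linearZ; congr (_ *: _).
rewrite -/(unit_sec V i) -(unit_sec_res VU i).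
by rewrite -!(hom_nat _ (@subset_refl _ _)) H.
Qed.

(** A functional on a free sheaf amounts to its values on the unit vectors, so both parts come from
    [qc_struct] with a common exponent. *)
Lemma qc_dual_free n : qc_on B (sheaf_dual (free_sheaf X n)) (open_full X).
Proof.
move=> s V VU e; have {e} : V = D s by rewrite e -(full_capE (erefl (D s))).
move=> ?; subst V; rewrite (Prop_irrelevance VU (sub_full _)); split=> [u u0|u].
  have [|i|k H] := @uniform_bound _ (fun (i : 'I_n) k =>
      s ^+ k *| u _ (@subset_refl _ _) (unit_sec _ i) = 0).
  - by move=> i a b; exact: gsc_exp_eq0.
  - apply: (@qc_torsion X B (struct_sheaf X)); first exact: qc_struct.
    rewrite (hom_nat u (@subset_refl _ _) (sub_full (D s))) unit_sec_res.
    have := congr1 (fun w : hom_on _ _ _ => w _ (@subset_refl _ _) (unit_sec _ i)) u0.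
    by rewrite /= (Prop_irrelevance (subset_trans _ _) (sub_full (D s))).
  exists k; apply: free_hom_unique => i; rewrite gsc_hom; exact: H.
have [|i|k /choice [c Hc]] := @uniform_bound _ (fun (i : 'I_n) k =>
    exists c : struct_sheaf X (open_full X),
      om_res (sub_full (D s)) c = s ^+ k *| u _ (@subset_refl _ _) (unit_sec _ i)).
- move=> i a b /subnK <- [c ec]; exists (s ^+ (b - a) *| c).
  by rewrite om_res_gsc ec gsc_expD.
- by apply: qc_extend; exact: qc_struct.
pose v0 (x : free_sheaf X n (open_full X)) : struct_sheaf X (open_full X) :=
  \sum_i (x : 'rV_n) 0 i *: c i.
have v0_lin : linear v0.
  move=> a x y; rewrite /v0 scaler_sumr -big_split /=; apply: eq_bigr => i _.
  by rewrite !mxE scalerDl scalerA.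
pose v0L : {linear free_sheaf X n (open_full X) -> struct_sheaf X (open_full X)} :=
  HB.pack v0 (GRing.isLinear.Build _ _ _ _ _ v0_lin).
have [v vE] := hom_extension (@qc_free X B n) v0L.
exists k, (omor_on v (open_full X)); apply: free_hom_unique => i.
rewrite gsc_hom -Hc -(unit_sec_res (sub_full (D s))) -/(unit_sec _ i).
transitivity (v (D s) (om_res (sub_full (D s)) (unit_sec (open_full X) i))) => //.
rewrite -omor_nat vE; congr (om_res _ _).
rewrite /= /v0 (bigD1 i) //= big1 ?addr0; first by rewrite mxE !eqxx scale1r.
by move=> j /negPf ji; rewrite mxE ji andbF scale0r.
Qed.

End GlobalImage.

(** * Presentations, duals and cokernels *)

Section ModuleLemmas.
Variable R : comPzRingType.

(** Any set-theoretic section [r] of [g] works: [b] does not depend on the choice of preimage, which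
    also gives linearity. *)
Lemma linear_factor (A M N : lmodType R) (g : {linear A -> M}) (b : {linear A -> N}) :
  (forall z, exists y, g y = z) -> (forall x, g x = 0 -> b x = 0) ->
  exists c : {linear M -> N}, forall x, c (g x) = b x.
Proof.
move=> /choice [r gr] gb.
have bE x y : g x = g y -> b x = b y.
  move=> e; apply/eqP; rewrite -subr_eq0 -linearB; apply/eqP/gb.
  by rewrite linearB e subrr.
have c_lin : linear (b \o r).
  by move=> a x y /=; rewrite -linearP; apply: bE; rewrite linearP !gr.
pose c : {linear M -> N} := HB.pack (b \o r) (GRing.isLinear.Build _ _ _ _ _ c_lin).
by exists c => x /=; apply: bE; rewrite gr.
Qed.

Lemma mod_coker_exact (A E L : lmodType R) (f : {linear A -> E}) (p : {linear E -> L}) :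
  (forall z, exists y, p y = z) -> (forall a, p (f a) = 0) ->
  (forall y, p y = 0 -> exists a, y = f a) -> mod_is_coker f L.
Proof.
move=> psurj pf kerp; exists p; split=> // N q qf.
have [|u uE] := linear_factor (g := p) (b := q) psurj.
  by move=> y /kerp [a ->].
exists u => // u' u'E z; have [y <-] := psurj z.
by rewrite u'E uE.
Qed.

(** Left exactness of Hom(-, R): [b] kills the image of [f], which is the kernel of [g], so it
    factors through the surjection [g]. *)
Lemma dual_left_exact (M : lmodType R) t1 t2 (f : {linear 'rV[R]_t2 -> 'rV[R]_t1})
    (g : {linear 'rV[R]_t1 -> M}) (b : mod_dual 'rV[R]_t1) :
  mod_presentation f g -> (forall x, (b : {linear _ -> _}) (f x) = 0) ->
  exists c : mod_dual M, b = mod_dual_map g c.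
Proof.
move=> [gf exf gsurj] bf.
have [|c cE] := linear_factor (g := g) (b := (b : {linear _ -> _})) gsurj.
  by move=> x /exf [y <-].
by exists c; apply: linear_ext => x /=; rewrite cE.
Qed.

End ModuleLemmas.

(** * Transfer of presentations and of linkage to global sections *)

Section Linkage.
Variables (X : ringed_space) (B : affine_basis X).
Implicit Types (E F G L N : omodule X) (U V W : opens X).
Local Notation D := (bopen B).
Local Notation T := (open_full X).

Lemma presentation_global G t1 t2 (phi : omorphism (free_sheaf X t2) (free_sheaf X t1))
    (vphi : omorphism (free_sheaf X t1) G) : qc_on B G T ->
  sheaf_presentation phi vphi ->
  mod_presentation (M := global_sections G) (phi T) (vphi T).
Proof.
move=> qG [[vphi0 ker] epi]; split=> [x|y y0|z]; first exact: vphi0.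
  by apply: (@global_image X B) (ker _ _ y0); exact: qc_free.
by apply: (@global_image X B) qG (epi _ z); exact: qc_free.
Qed.

(** Sections are locally fractions, so denominators are cleared, the equation is solved by global
    sections, and the solution is divided again. *)
Lemma presentation_sheaf G t1 t2 (phi : omorphism (free_sheaf X t2) (free_sheaf X t1))
    (vphi : omorphism (free_sheaf X t1) G) : qc_on B G T ->
  mod_presentation (M := global_sections G) (phi T) (vphi T) ->
  sheaf_presentation phi vphi.
Proof.
move=> qG [vphi0 ker epi]; split; first split.
- move=> U a.
  pose zero : omorphism (free_sheaf X t2) G :=
    @OMorphism X _ G (fun U => \0 : {linear _ -> G U})
      (fun U V VU x => linear0 _).
  apply: (@omor_unique X B _ _ (omor_comp vphi phi) zero (@qc_free X B t2)).
  exact: vphi0.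
- move=> U b b0 z Uz.
  have [V [VU [s [a [Vz Vs e]]]]] := qc_fraction b (@qc_free X B t1) Uz.
  have [h [hV hz]] := bopen_basis B Vz; have hU := subset_trans hV VU.
  (* [h ^+ m] kills [vphi T a], so [h ^+ m *| a] is the image of a global [x], and on [D h] the
     section [b] is the image of [x] divided by [h ^+ m * s]. *)
  have [|m em] := @qc_torsion X B G h (vphi T a) qG.
    rewrite omor_nat -(om_res_comp (sub_full V) hV) -e om_res_gsc omor_gsc.
    by rewrite (om_res_comp _ _ hU) -omor_nat b0 linear0 gsc0r.
  have [|x ex] := ker (h ^+ m *| a : free_sheaf X t1 T).
    by move: em; rewrite -omor_gsc.
  have hs : D h `<=` D (h ^+ m * s).
    by rewrite bopenM => w hw; split; [exact: bopenX|exact/Vs/hV].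
  have [y ey] := gsc_div (om_res (sub_full _) (x : free_sheaf X t2 T)) hs.
  exists (D h), hU; split=> //; exists y; apply: (gsc_inj hs).
  rewrite -omor_gsc ey -omor_nat ex om_res_gsc -gscA; congr (_ *| _).
  by rewrite -(om_res_comp (sub_full V) hV) -e om_res_gsc (om_res_comp _ _ hU).
- move=> U b z Uz.
  have [V [VU [s [a [Vz Vs e]]]]] := qc_fraction b qG Uz.
  have [x ex] := epi a.
  have [y ey] := gsc_div (om_res (sub_full V) (x : free_sheaf X t1 T)) Vs.
  exists V, VU; split=> //; exists y; apply: (gsc_inj Vs).
  by rewrite e -omor_gsc ey -omor_nat ex.
Qed.

Lemma presented_iff G t1 t2 : qc_on B G T ->
  (sheaf_presented G t1 t2 <-> mod_presented (global_sections G) t1 t2).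
Proof.
move=> qG; split=> [[phi [vphi P]]|[f [g P]]].
  by exists (phi T), (vphi T); apply: presentation_global.
have [phi phiE] := @hom_extension X B (free_sheaf X t2) (free_sheaf X t1)
  (@qc_free X B t2) f.
have [vphi vphiE] := @hom_extension X B (free_sheaf X t1) G (@qc_free X B t1) g.
exists phi, vphi; apply: presentation_sheaf => //.
by rewrite (linear_ext phiE) (linear_ext vphiE).
Qed.

Lemma least_ranks_iff (P Q : nat -> nat -> Prop) t1 t2 :
  (forall s1 s2, P s1 s2 <-> Q s1 s2) -> least_ranks P t1 t2 <-> least_ranks Q t1 t2.
Proof.
by move=> PQ; split=> -[H Hmin]; split=> [|s1 s2 /PQ];
  [exact/PQ|exact: Hmin|exact/PQ|exact: Hmin].
Qed.

Definition dual_full E (c : sheaf_dual E T) : mod_dual (global_sections E) :=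
  hom_fun c (@subset_refl _ _).

Lemma dual_full_inj E : qc_on B E T -> injective (@dual_full E).
Proof.
move=> qE c d e; apply: (@hom_full_unique X B) qE _ => x.
by have := congr1 (fun w : mod_dual (global_sections E) => (w : {linear _ -> _}) x) e.
Qed.

(** By [hom_extension] and uniqueness, evaluation on global sections is bijective; its inverse
    inherits linearity from it. *)
Lemma dual_extension E : qc_on B E T ->
  exists ext : {linear mod_dual (global_sections E) -> sheaf_dual E T},
    cancel ext (@dual_full E) /\ cancel (@dual_full E) ext.
Proof.
move=> qE.
have /choice [ext extK] : forall b : mod_dual (global_sections E),
    exists c : sheaf_dual E T, dual_full c = b.
  move=> b; have [u uE] := @hom_extension X B E (struct_sheaf X) qE b.
  by exists (omor_on u T); apply: linear_ext.
have ext_lin : linear ext.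
  move=> a b c; apply: (dual_full_inj qE); rewrite extK.
  apply: linear_ext => x; rewrite /dual_full /=.
  rewrite rs_res_id.
  by rewrite -[in LHS](extK b) -[in LHS](extK c).
pose extL : {linear mod_dual (global_sections E) -> sheaf_dual E T} :=
  HB.pack ext (GRing.isLinear.Build _ _ _ _ _ ext_lin).
by exists extL; split=> // c; apply: (dual_full_inj qE); apply: extK.
Qed.

Lemma dual_full_map E F (p : omorphism E F) (c : sheaf_dual F T) :
  dual_full (sheaf_dual_map p T c) =
  mod_dual_map (p T : {linear global_sections E -> global_sections F}) (dual_full c).
Proof. exact: linear_ext. Qed.

Lemma dual_extension_map E F (p : omorphism E F) extE extF
    (c : mod_dual (global_sections F)) : qc_on B E T ->
  cancel extE (@dual_full E) -> cancel extF (@dual_full F) ->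
  extE (mod_dual_map (p T : {linear global_sections E -> global_sections F}) c) =
  sheaf_dual_map p T (extF c).
Proof.
move=> qE EK FK; apply: (dual_full_inj qE).
by rewrite EK dual_full_map FK.
Qed.

Lemma coker_global G L t1 t2 (phi : omorphism (free_sheaf X t2) (free_sheaf X t1))
    (vphi : omorphism (free_sheaf X t1) G) :
  qc_on B G T -> qc_on B L T -> sheaf_presentation phi vphi ->
  sheaf_is_coker (sheaf_dual_map vphi) L ->
  mod_is_coker (mod_dual_map (vphi T : {linear _ -> global_sections G})
    : {linear mod_dual _ -> mod_dual _}) (global_sections L).
Proof.
move=> qG qL presG [p [p0 puniv]].
have [ext [extK Kext]] := dual_extension (@qc_free X B t1).
have [extG [extGK _]] := dual_extension qG.
have [[vphi0 _] _] := presG.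
apply: (@mod_coker_exact _ _ _ _ _ (p T \o ext : {linear _ -> L T})).
(* Surjectivity: [p] is epi as a sheaf cokernel, and [global_image] lifts a global section since
   both sheaves are quasi-coherent. *)
- move=> z; have [|a <-] := @global_image X B _ _ p z (@qc_dual_free X B t1) qL.
    apply: coker_epi => [N q qp|u uE].
      by have [|u uE _] := puniv N q; [move=> U a; apply/qp/p0|exists u].
    have [v _ vU] := puniv L p p0.
    by move=> U b; rewrite (vU u) // -(vU (omor_id L)).
  by exists (dual_full a); rewrite /= Kext.
- move=> c; apply: etrans (p0 T (extG c)); congr (p T _).
  by apply: dual_extension_map => //; exact: qc_free.
- move=> b /= pb.
  (* As the dual of [phi] factors through [p], any [b] killed by the projection vanishes on the
     image of [phi T], so it comes from a functional on the global sections of [G]. *)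
  have [|u uE _] := puniv _ (sheaf_dual_map phi).
    move=> U a; apply: hom_on_ext => V VU x /=.
    by rewrite vphi0 linear0.
  have [|c ->] := dual_left_exact (b := b) (presentation_global qG presG);
    last by exists c.
  move=> x; have /(congr1 (@dual_full _)) : sheaf_dual_map phi T (ext b) = 0.
    by rewrite -uE pb linear0.
  rewrite dual_full_map extK.
  by move/(congr1 (fun w : mod_dual _ => (w : {linear _ -> _}) x)).
Qed.

(** The projection is the extension of the module projection; factorizations are found on global
    sections and extended from [L], which is quasi-coherent. *)
Lemma coker_sheaf G L t1 t2 (phi : omorphism (free_sheaf X t2) (free_sheaf X t1))
    (vphi : omorphism (free_sheaf X t1) G) :
  qc_on B G T -> qc_on B L T -> sheaf_presentation phi vphi ->
  mod_is_coker (mod_dual_map (vphi T : {linear _ -> global_sections G})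
    : {linear mod_dual _ -> mod_dual _}) (global_sections L) ->
  sheaf_is_coker (sheaf_dual_map vphi) L.
Proof.
move=> qG qL presG [p [p0 puniv]].
have qE := @qc_dual_free X B t1.
have [ext [extK Kext]] := dual_extension (@qc_free X B t1).
have [extG [extGK _]] := dual_extension qG.
have [[vphi0 _] _] := presG.
have pd_lin : linear (p \o @dual_full (free_sheaf X t1)).
  move=> a x y /=; rewrite -linearP; congr (p _); apply: linear_ext => z.
  by rewrite /dual_full /= rs_res_id.
pose pd : {linear sheaf_dual (free_sheaf X t1) T -> L T} :=
  HB.pack (p \o @dual_full (free_sheaf X t1)) (GRing.isLinear.Build _ _ _ _ _ pd_lin).
have [P PE] := hom_extension qE pd.
exists P; split=> [U w|N q qv].
  (* Instead of [w], its image in the dual of the free sheaf is written locally as [a / s]. There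
     [h ^+ m *| a] is annihilated by the dual of [phi], hence comes from a functional on
     [global_sections G] and is killed by [P]. *)
  apply: sheaf_sep => z Uz.
  have [V [VU [s [a [Vz Vs e]]]]] := qc_fraction (sheaf_dual_map vphi U w) qE Uz.
  have [h [hV hz]] := bopen_basis B Vz; have hU := subset_trans hV VU.
  have {}e : s *| om_res hU (sheaf_dual_map vphi U w) = om_res (sub_full _) a.
    by rewrite -(om_res_comp (sub_full V) hV) -e om_res_gsc (om_res_comp _ _ hU).
  have vv W (x : sheaf_dual G W) : sheaf_dual_map phi W (sheaf_dual_map vphi W x) = 0.
    by apply: hom_on_ext => W' W'W y /=; rewrite vphi0 linear0.
  have [|m em] := @qc_torsion X B _ h (sheaf_dual_map phi T a)
      (@qc_dual_free X B t2).
    by rewrite omor_nat -e omor_gsc -!omor_nat vv linear0 gsc0r.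
  have [|c cE] := dual_left_exact (b := dual_full (h ^+ m *| a))
      (presentation_global qG presG).
    move=> x; move: em; rewrite -omor_gsc => /(congr1 (@dual_full _)).
    rewrite dual_full_map.
    by move/(congr1 (fun w : mod_dual _ => (w : {linear _ -> _}) x)).
  have P0 : P T (h ^+ m *| a) = 0.
    by rewrite PE; apply: etrans (p0 c); apply: (congr1 p cE).
  exists (D h), hU; split=> //.
  have hs : D h `<=` D (h ^+ m * s).
    by rewrite bopenM => v hv; split; [exact: bopenX|exact/Vs/hV].
  apply: (gsc_eq0 hs).
  by rewrite -gscA omor_nat -omor_gsc e -omor_gsc -om_res_gsc -omor_nat P0 linear0.
have [|u0 u0E u0U] := puniv (N T) (q T \o ext : {linear _ -> N T}).
  move=> c; apply: etrans (qv T (extG c)); congr (q T _).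
  by apply: dual_extension_map => //; exact: qc_free.
have [u uE] := hom_extension qL u0.
exists u => [U b|u' u'E].
  apply: (@omor_unique X B _ _ (omor_comp u P) q qE) => x.
  by rewrite /= PE uE /= u0E /= Kext.
apply: omor_unique qL _ => z; rewrite uE.
apply: (u0U (u' T)) => b.
by rewrite /= -u'E PE /= extK.
Qed.

(** [presented_iff] makes the minimal ranks agree; by [hom_extension] a module presentation of those
    ranks is the global part of a sheaf presentation. *)
Lemma lambda_iff G L : qc_on B G T -> qc_on B L T ->
  (sheaf_is_lambda G L <-> mod_is_lambda (global_sections G) (global_sections L)).
Proof.
move=> qG qL.
have ranks := fun t1 t2 =>
  least_ranks_iff t1 t2 (fun s1 s2 => presented_iff s1 s2 qG).
split=> [[t1 [t2 [phi [vphi [presG /ranks least coker]]]]]|].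
  exists t1, t2, (phi T), (vphi T); split=> //.
    exact: (presentation_global qG presG).
  exact: (coker_global qG qL presG coker).
move=> [t1 [t2 [f [g [presG /ranks least coker]]]]].
have [phi phiE] := @hom_extension X B (free_sheaf X t2) (free_sheaf X t1)
  (@qc_free X B t2) f.
have [vphi vphiE] := @hom_extension X B (free_sheaf X t1) G (@qc_free X B t1) g.
have pres : sheaf_presentation phi vphi.
  by apply: presentation_sheaf => //; rewrite (linear_ext phiE) (linear_ext vphiE).
exists t1, t2, phi, vphi; split=> //.
by apply: (coker_sheaf qG qL pres); rewrite (linear_ext vphiE).
Qed.

End Linkage.

Theorem corollary4p3 (X : ringed_space) (F G : omodule X) :
  affine_scheme X -> noetherian_scheme X -> connected [set: X] ->
  coherent F -> coherent G ->
  (sheaf_linked F G <-> mod_linked (global_sections F) (global_sections G)).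
Proof.
move=> /affine_basis_exists [B] _ _ cohF cohG.
have qF := @coherent_qc X B F cohF; have qG := @coherent_qc X B G cohG.
have FG := lambda_iff qF qG; have GF := lambda_iff qG qF.
by split=> -[/GF ? /FG ?].
Qed.
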